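(* Let $\pi$ be an irreducible cuspidal representation of $\mathrm{GL}_4(\mathbb F)$ associated with the regular multiplicative character $\theta:\mathbb F_4^*\to\mathbb C^*$, where $\mathbb F_4$, $\mathbb F_2$ denote the field extensions of $\mathbb F$ of degree $4$ and $2$, and suppose that the restriction $\theta|_{\mathbb F_2^*}$ is non-trivial. Write $\mathrm{Tr}=\mathrm{Tr}_{\mathbb F_4/\mathbb F}$ and $\mathrm N=\mathrm N_{\mathbb F_4/\mathbb F}$. Then $$\gamma(\pi,\wedge^2,\psi)=q^{-2}T_0-\frac12q^{-3}G_\psi(\theta)\sum_{\xi\in\mathbb F_4^*}\theta(\xi^2)K_\psi\left(1,\mathrm{Tr}\left(\frac1{\xi^2}\right)+\frac{\mathrm{Tr}(\xi^2)}{\mathrm N(\xi)}\right)-\frac12q^{-3}G_\psi(\theta)\sum_{\xi\in\mathbb F_4^*}\theta(\xi^2)K_\psi\left(1,\mathrm{Tr}\left(\frac1{\xi^2}\right)-\frac{\mathrm{Tr}(\xi^2)}{\mathrm N(\xi)}\right),$$ where $G_\psi(\theta)=\sum_{a\in\mathbb F^*}\theta(a^{-1})\psi(a)$ is the Gauss sum, $K_\psi(a,b)=\sum_{x\in\mathbb F^*}\psi(ax)\psi(bx^{-1})$ is the Kloosterman sum, and $T_0=q^2-1$ if the central character $\omega_\pi$ of $\pi$ is trivial and $T_0=0$ otherwise.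
   Context: $\mathbb F$ is a finite field with $q$ elements, $\psi:\mathbb F\to\mathbb C^*$ is a non-trivial additive character, and $\mathbb F_k$ denotes the degree $k$ extension of $\mathbb F$ inside a fixed algebraic closure. Correspondence with regular characters: a character $\theta$ of $\mathbb F_n^*$ is regular if $\theta^{q^k}\ne\theta$ for $1\le k\le n-1$. Irreducible cuspidal representations of $\mathrm{GL}_n(\mathbb F)$ are in bijection with Galois orbits of regular characters of $\mathbb F_n^*$ (Green, Gelfand): $\pi$ is associated with $\theta$ when its character satisfies $\mathrm{tr}\,\pi(g)=0$ unless the characteristic polynomial of $g$ is a power of an irreducible polynomial of some degree $d\mid n$, and in that case $\mathrm{tr}\,\pi(g)=(-1)^{n-1}\left(\sum_{i=0}^{d-1}\theta(\alpha^{q^i})\right)\prod_{j=1}^{k-1}(1-q^{dj})$, where $\alpha\in\mathbb F_d$ is an eigenvalue of $g$ and $k=\dim_{\mathbb F_d}\ker(g-\alpha)$. Gamma factor for $\mathrm{GL}_{2m}$ (here $m=2$): $M=M_m(\mathbb F)$, $G=\mathrm{GL}_m(\mathbb F)$, $\mathcal B\subseteq M$ the upper triangular matrices, $N\le G$ the upper triangular unipotent subgroup; $N_{2m}\le\mathrm{GL}_{2m}(\mathbb F)$ the upper triangular unipotent subgroup, $\psi(u)=\psi(\sum_iu_{i,i+1})$ for $u\in N_{2m}$. $\mathcal W(\pi,\psi)$ is the Whittaker model: the functions $g\mapsto\ell(\pi(g)v)$, $v\in V_\pi$, where $0\ne\ell\in\mathrm{Hom}_{N_{2m}}(\pi,\psi)$;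 the group acts by right translation. $\tilde W(g)=W(w_{2m}\,{}^tg^{-1})\in\mathcal W(\tilde\pi,\psi^{-1})$, $w_{2m}$ the matrix with ones on the antidiagonal, $\tilde\pi$ the contragredient. $\mathcal S(\mathbb F^m)$ is the space of functions $\mathbb F^m\to\mathbb C$ and $\mathcal F_\psi\phi(y)=q^{-m/2}\sum_x\phi(x)\psi(\langle x,y\rangle)$. Define $$J_{\pi,\psi}(W,\phi)=\frac1{[G:N][M:\mathcal B]}\sum_{g\in N\backslash G}\ \sum_{X\in\mathcal B\backslash M}W\left(\sigma_{2m}\begin{pmatrix}I_m&X\\ &I_m\end{pmatrix}\begin{pmatrix}g&\\ &g\end{pmatrix}\right)\psi(-\mathrm{tr}X)\,\phi(\varepsilon g),$$ $\varepsilon=(0,\dots,0,1)$, $\sigma_{2m}$ the permutation matrix whose $j$-th column is $e_{\sigma(j)}$ with $\sigma(j)=2j-1$, $\sigma(m+j)=2j$ ($1\le j\le m$), and $\tilde J_{\pi,\psi}(W,\phi)=J_{\tilde\pi,\psi^{-1}}\left(\tilde\pi\begin{pmatrix}&I_m\\ I_m&\end{pmatrix}\tilde W,\mathcal F_\psi\phi\right)$. If $\pi$ admits no Shalika vector (a vector $0\ne v$ with $\pi\begin{pmatrix}g&X\\ &g\end{pmatrix}v=\psi(\mathrm{tr}(Xg^{-1}))v$ for all $g\in\mathrm{GL}_m(\mathbb F)$, $X\in M_m(\mathbb F)$), which is equivalent to $\theta|_{\mathbb F_m^*}$ being non-trivial, then $\gamma(\pi,\wedge^2,\psi)\in\mathbb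 C^*$ is the unique non-zero constant (it exists) such that $\tilde J_{\pi,\psi}(W,\phi)=\gamma(\pi,\wedge^2,\psi)J_{\pi,\psi}(W,\phi)$ for all $W\in\mathcal W(\pi,\psi)$, $\phi\in\mathcal S(\mathbb F^m)$. *)

(* Defs.v *)
From HB Require Import structures.
From mathcomp Require Import all_boot all_order all_algebra.
From mathcomp Require Import all_fingroup all_solvable all_field all_character.

Set Implicit Arguments.
Unset Strict Implicit.
Unset Printing Implicit Defensive.

Import Order.TTheory GRing.Theory Num.Theory.
Local Open Scope ring_scope.

Section Characters.

Variables (F : finFieldType) (C : numClosedFieldType).

Definition additive_char (psi : F -> C) : Prop :=
  psi 0 = 1 /\ forall x y, psi (x + y) = psi x * psi y.

(* A multiplicative character is a function on the whole field of which only
   the values at nonzero arguments are meaningful. *)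
Definition multiplicative_char (L : fieldType) (theta : L -> C) : Prop :=
  theta 1 = 1 /\
  forall x y, x != 0 -> y != 0 -> theta (x * y) = theta x * theta y.

Definition kloosterman (psi : F -> C) (a b : F) : C :=
  \sum_(x : F | x != 0) psi (a * x) * psi (b * x^-1).

End Characters.

Section Extension.

Variables (F : finFieldType) (C : numClosedFieldType) (L : fieldExtType F).

Definition nontrivial_on (theta : L -> C) (K : {subfield L}) : Prop :=
  exists x, [/\ x \in K, x != 0 & theta x != 1].

Definition regular_char (theta : L -> C) : Prop :=
  multiplicative_char theta /\
  forall k, (1 <= k <= (\dim {:L}).-1)%N ->
    exists2 x, x != 0 & theta x ^+ (#|F| ^ k) != theta x.

(* The inverse of the embedding a |-> a%:A of F in L; junk outside its image. *)
Definition descend (x : L) : F := odflt 0 [pick a : F | a%:A == x].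

(* finvect_type L is L with its structures of finite field and of splitting
   field over F. *)
Definition trace_ext (x : L) : F :=
  descend (galTrace 1 {: finvect_type L} (x : finvect_type L)).

Definition norm_ext (x : L) : F :=
  descend (galNorm 1 {: finvect_type L} (x : finvect_type L)).

Lemma descendK (x : L) : x \in 1%VS -> (descend x)%:A = x.
Proof.
case/vlineP=> a ->; rewrite /descend.
by case: pickP => [b /eqP // | /(_ a)]; rewrite eqxx.
Qed.

Lemma trace_extE (x : L) :
  (trace_ext x)%:A = galTrace 1 {: finvect_type L} (x : finvect_type L).
Proof.
apply: descendK.
have /galois_fixedField fixE := @finField_galois _ (finvect_type L) 1%AS fullv (sub1v _).
by have := galTrace_fixedField 1%AS (memvf (x : finvect_type L)); rewrite fixE.
Qed.

Lemma norm_extE (x : L) :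
  (norm_ext x)%:A = galNorm 1 {: finvect_type L} (x : finvect_type L).
Proof.
apply: descendK.
have /galois_fixedField fixE := @finField_galois _ (finvect_type L) 1%AS fullv (sub1v _).
by have := galNorm_fixedField 1%AS (memvf (x : finvect_type L)); rewrite fixE.
Qed.

Definition gauss_sum (psi : F -> C) (theta : L -> C) : C :=
  \sum_(a : F | a != 0) theta ((a^-1)%:A) * psi a.

End Extension.

Section Representations.

Variables (F : finFieldType) (C : numClosedFieldType).

(* The element of GL_n with matrix A, for A invertible (the identity otherwise). *)
Definition toGL n (A : 'M[F]_n.-1.+1) : {'GL_n[F]} := insubd (1%g : {'GL_n[F]}) A.

Lemma toGLK n (A : 'M[F]_n.-1.+1) : A \in unitmx -> GLval (toGL A) = A.
Proof. by move=> uA; apply: (insubdK (1%g : {'GL_n[F]})). Qed.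

(* The unipotent radical of the standard maximal parabolic subgroup of
   type (r, n - r). *)
Definition unip_radical (n r : nat) : {set {'GL_n[F]}} :=
  [set u : {'GL_n[F]} | [forall i : 'I_n.-1.+1, forall j : 'I_n.-1.+1,
     (i < r <= j)%N || (GLval u i j == (i == j)%:R)]].

Definition unip_upper (n : nat) : {set {'GL_n[F]}} :=
  [set u : {'GL_n[F]} | [forall i : 'I_n.-1.+1, forall j : 'I_n.-1.+1,
     (j <= i)%N ==> (GLval u i j == (i == j)%:R)]].

Definition psi_unip n (psi : F -> C) (u : {'GL_n[F]}) : C :=
  psi (\sum_(i < n.-1.+1) \sum_(j < n.-1.+1 | j == i.+1 :> nat) GLval u i j).

Section OneRepresentation.

Variables (n d : nat) (pi : mx_representation C 'GL_n[F] d).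

(* pi acts on column vectors by v |-> pi g *m v, and linear forms on the space
   of pi are row vectors. *)

Definition cuspidal : Prop :=
  forall r, (0 < r < n)%N -> forall v : 'cV[C]_d,
    (forall u, u \in unip_radical n r -> pi u *m v = v) -> v = 0.

Definition central_character (omega : F -> C) : Prop :=
  forall a, a != 0 -> pi (toGL a%:M) = (omega a)%:M.

(* In the second clause E is the extension of F of degree deg p, in which
   a is an eigenvalue of g. *)
Definition associated (L : fieldExtType F) (theta : L -> C) : Prop :=
  forall g : {'GL_n[F]},
    ((~ exists (p : {poly F}) (e : nat),
          [/\ irreducible_poly p, ((size p).-1 %| n)%N
            & char_poly (GLval g) = p ^+ e]) ->
      \tr (pi g) = 0)
    /\
    (forall (p : {poly F}) (e : nat) (E : {subfield L}) (a : subvs_of E),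
      irreducible_poly p -> ((size p).-1 %| n)%N ->
      char_poly (GLval g) = p ^+ e ->
      \dim E = (size p).-1 ->
      let gE := map_mx (in_alg (subvs_of E)) (GLval g) in
      eigenvalue gE a ->
      let k := \rank (kermx (gE - a%:M)) in
      \tr (pi g) =
        (-1) ^+ n.-1
        * (\sum_(i < \dim E) theta (vsval a ^+ (#|F| ^ i)))
        * \prod_(1 <= j < k) (1 - #|F|%:R ^+ (\dim E * j))).

Definition whittaker_model (psi : F -> C) (W : {'GL_n[F]} -> C) : Prop :=
  exists (l : 'rV[C]_d) (v : 'cV[C]_d),
    [/\ l != 0,
        forall u, u \in unip_upper n -> l *m pi u = psi_unip psi u *: l
      & forall g, W g = (l *m pi g *m v) 0 0].

End OneRepresentation.

Definition antidiag_mx n : 'M[F]_n := \matrix_(i, j) (i == rev_ord j)%:R.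

Definition whittaker_dual n (W : {'GL_n[F]} -> C) (g : {'GL_n[F]}) : C :=
  W (toGL (antidiag_mx _ *m (invmx (GLval g))^T)).

(* The group is GL_{2m} with m = m'.+1. *)
Section JacquetShalika.

Variable m' : nat.
Local Notation m := m'.+1.
Local Notation GL2m := {'GL_(m + m)[F]}.

Definition fourier (psi : F -> C) (phi : 'rV[F]_m -> C) (y : 'rV[F]_m) : C :=
  sqrtC (#|F|%:R) ^- m * \sum_(x : 'rV[F]_m) phi x * psi (\sum_i x 0 i * y 0 i).

Definition shuffle (j : nat) : nat :=
  if (j < m)%N then j.*2 else (j - m).*2.+1.

(* Indices start from 0. *)
Definition shuffle_mx : 'M[F]_(m + m) :=
  \matrix_(i, j) (i == shuffle j :> nat)%:R.

Definition swap_mx : 'M[F]_(m + m) := block_mx 0 1%:M 1%:M 0.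

Definition upper_mx : {set 'M[F]_m} :=
  [set X : 'M[F]_m | [forall i : 'I_m, forall j : 'I_m, (j < i)%N ==> (X i j == 0)]].

(* rcosets upper_mx [set: 'M_m] is the quotient of the additive group M_m by
   upper_mx.  The sums use a representative of each coset. *)
Definition JS (psi : F -> C) (W : GL2m -> C) (phi : 'rV[F]_m -> C) : C :=
  let N := unip_upper m in
  let G := [set: {'GL_m[F]}] in
  let M := [set: 'M[F]_m] in
  (#|G : N|%g%:R * #|M : upper_mx|%g%:R)^-1 *
  \sum_(A in rcosets N G) \sum_(Y in rcosets upper_mx M)
    let g : 'M[F]_m := GLval (repr A) in
    let X : 'M[F]_m := repr Y in
    W (@toGL (m + m) (shuffle_mx *m block_mx 1%:M X 0 1%:M *m block_mx g 0 0 g))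
    * psi (- \tr X) * phi (delta_mx 0 ord_max *m g).

Definition JS_dual (psi : F -> C) (W : GL2m -> C) (phi : 'rV[F]_m -> C) : C :=
  JS (fun x => (psi x)^-1)
     (fun g => whittaker_dual W (g * @toGL (m + m) swap_mx)%g)
     (fourier psi phi).

Definition ext_square_gamma d (pi : mx_representation C 'GL_(m + m)[F] d)
    (psi : F -> C) (gamma : C) : Prop :=
  gamma != 0 /\
  forall W phi, whittaker_model pi psi W ->
    JS_dual psi W phi = gamma * JS psi W phi.

End JacquetShalika.

End Representations.

(* Main.v *)
From HB Require Import structures.
Require Import Defs.
From mathcomp Require Import all_boot all_order all_algebra.
From mathcomp Require Import all_fingroup all_solvable all_field all_character.
From mathcomp Require Import ring zify.

(** The formula of [theorem2p39] rests on the Bessel function and on the values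
of the character of [pi].

Both sides of the functional equation that defines [gamma] are linear in the
Whittaker function.  Let [N] be the group of upper triangular unipotent matrices
of GL_4 and [e] the average of [psi(u)^-1 pi(u)] over [N].  The Bessel function
[bessel g = tr (e pi(g))] is a sum of Whittaker functions, one for each row of
[e], so its right translate by the shuffle satisfies the functional equation
([gamma_bessel]).  It is equivariant under [N] on both sides, and this forces it
to vanish on most double cosets.

Take for [phi] the indicator of the last coordinate vector.  The sums over cosets
are averages over all of GL_2 and M_2 ([JS_average]).  On the original side only
the identity of GL_4 contributes, and [bessel 1 = 1] ([bessel_one]).  On the dual
side there remain the scalar matrices and, for [g] in the big cell of GL_2, the
matrices [0 b; c 0] with scalar 2 x 2 blocks ([JS_dual_row_delta]).  Hence
([gamma_bessel_sum])

  gamma = q^-1 sum_a theta(a) + q sum_(b, c) psi(1/b) bessel [0 b; c 0].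

The homogeneity of [bessel] under scalar matrices turns the sum over [c] into the
Gauss sum ([sum_gauss]), and it remains to find [bessel [0 t; 1 0]].  Up to
conjugation, the elements of the coset of [0 t; 1 0] modulo [N] are the matrices
[0 t n_s; 1 Z], where [n_s] is unipotent with corner [s], and the characteristic
polynomial of such a matrix is [det (X^2 - X Z - t n_s)].  The character formula,
written as a sum over the eigenvalues [x] in the field with q^4 elements
([character_formula]), reduces everything to two weighted counts of pairs [(s, Z)].
- The pairs whose characteristic polynomial has the conjugates of [x] as its roots
  exist only if [N x = t^2], and give q times the Kloosterman sum
  [K (1, Tr x + t Tr (1/x))] ([sum_same_char_poly]).
- When in addition the eigenspace of [x] is a plane, the sum over [s] cancels
  unless [x] is of degree 2 with norm [- t] ([sum_same_pencil]).

In the sum over [t] of the first terms put [x = t z].  Then [N z = t^-2], so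
[z = y^2] with [1/t = N y] or [1/t = - N y], and each [(t, z)] comes from two
choices of [y] and the sign: these are the two sums of the theorem, with their
factor 1/2 ([sum_norm_square]).  The second terms add up to the sum of [theta^-1]
over the elements of degree exactly 2, which is minus its sum over the nonzero
elements of the base field as [theta] is nontrivial on the field with q^2 elements
([sum_quadratic_conj]).  Together with the scalar matrices they make up the term
in [T0] ([gamma_identity]). *)

Set Implicit Arguments.
Unset Strict Implicit.
Unset Printing Implicit Defensive.

Import Order.TTheory GRing.Theory Num.Theory.
Local Open Scope ring_scope.

(** * Conjugates in a field extension of degree 4 *)

Section Frobenius.

Variables (F K : finFieldType) (emb : {rmorphism F -> K}).
Local Notation q := #|F|.

(** The embedding is an argument because additivity depends on it: it forces the
characteristic of [K] to be that of [F]. *)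
Definition frob (f : {rmorphism F -> K}) (x : K) : K := x ^+ #|F|.

Lemma pchar_nat_card : [pchar K].-nat q.
Proof.
have [p p_pr pF] := finPcharP F.
have pK : p \in [pchar K] by rewrite (fmorph_pchar emb).
rewrite (eq_pnat _ (pcharf_eq pK)).
have -> : q = #|pPrimeCharType pF| by [].
by rewrite card_pprimeChar pnatX pnat_id.
Qed.

End Frobenius.

Section FrobMorphism.

Variables (F K : finFieldType) (emb : {rmorphism F -> K}).
Local Notation q := #|F|.

Fact frob_additive : zmod_morphism (frob emb).
Proof.
move=> x y; rewrite /frob exprDn_pchar ?(pchar_nat_card emb) //.
congr (_ + _); apply: (addrI (y ^+ q)).
rewrite -exprDn_pchar ?(pchar_nat_card emb) // !subrr expr0n gtn_eqF //.
exact: ltnW (finNzRing_gt1 F).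
Qed.

Fact frob_multiplicative : monoid_morphism (frob emb).
Proof. by split=> [|x y]; rewrite /frob ?expr1n ?exprMn. Qed.

HB.instance Definition _ :=
  GRing.isZmodMorphism.Build K K (frob emb) frob_additive.
HB.instance Definition _ :=
  GRing.isMonoidMorphism.Build K K (frob emb) frob_multiplicative.

Lemma frob_emb a : frob emb (emb a) = emb a.
Proof. by rewrite /frob -rmorphXn /= expf_card. Qed.

(** The fixed points are roots of [X^q - X], which splits over [F]. *)
Lemma frob_fixed x : frob emb x = x -> exists a, x = emb a.
Proof.
move=> fx; have: root (map_poly emb ('X^q - 'X)) x.
  by rewrite rmorphB /= map_polyXn map_polyX rootE !hornerE -/(frob emb x) fx subrr.
rewrite finField_genPoly rmorph_prod /=.
under eq_bigr do rewrite rmorphB /= map_polyX map_polyC /=.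
rewrite rootE horner_prod prodf_seq_eq0 => /hasP[a _ /=].
by rewrite !hornerE subr_eq0 => /eqP ->; exists a.
Qed.

Lemma poly_descent (p : {poly K}) :
  map_poly (frob emb) p = p -> exists r, p = map_poly emb r.
Proof.
move=> fp.
have aP i : exists a, p`_i == emb a.
  have /frob_fixed[a ->] : frob emb p`_i = p`_i by rewrite -coef_map fp.
  by exists a.
exists (\poly_(i < size p) xchoose (aP i)); apply/polyP=> i.
rewrite coef_map coef_poly; case: ltnP => [_|le]; first exact/eqP/(xchooseP (aP i)).
by rewrite [RHS]rmorph0 nth_default.
Qed.

Section DegreeFour.

Hypothesis cardK : #|K| = (q ^ 4)%N.

Definition conj_poly (xi : K) : {poly K} := \prod_(i < 4) ('X - (xi ^+ (q ^ i))%:P).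

(** The degree of [xi] over [F], in the form in which it is used: the subfields of
[K] are the fixed fields of the powers of the Frobenius. *)
Definition conj_degree (xi : K) : nat :=
  if xi ^+ q == xi then 1 else if xi ^+ (q ^ 2) == xi then 2 else 4.

Definition orbit_poly (xi : K) : {poly K} :=
  \prod_(i < conj_degree xi) ('X - (xi ^+ (q ^ i))%:P).

Lemma conj_degree_dvd xi : (conj_degree xi %| 4)%N.
Proof. by rewrite /conj_degree; do 2?case: ifP. Qed.

Lemma frob_period xi : xi ^+ (q ^ conj_degree xi) = xi.
Proof.
rewrite /conj_degree; case: eqP => [|_]; first by rewrite expn1.
by case: eqP => // _; rewrite -cardK expf_card.
Qed.

Lemma frob_inj : injective (frob emb). Proof. exact: fmorph_inj. Qed.

Lemma iter_frob_inj n : injective (fun x : K => x ^+ (q ^ n)).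
Proof.
elim: n => [x y|n IH x y]; rewrite ?expn0 ?expr1 // expnSr !exprM => /frob_inj.
exact: IH.
Qed.

Lemma frob_not_fixed xi n : (0 < n < conj_degree xi)%N -> xi ^+ (q ^ n) != xi.
Proof.
move=> /andP[n_gt0]; rewrite /conj_degree; case: eqP => [_|ne1].
  by case: n n_gt0 => // [[]].
case: eqP => [_|ne2].
  by case: n n_gt0 => [|[|[|n]]] // _ _; rewrite expn1; apply/eqP.
case: n n_gt0 => [|[|[|[|n]]]] // _ _; apply/eqP => //.
move=> e3; apply: ne1; rewrite -{1}e3 -exprM -expnSr -cardK.
exact: expf_card.
Qed.

Definition conjugates (xi : K) : seq K :=
  [seq xi ^+ (q ^ i) | i <- iota 0 (conj_degree xi)].

(** A coincidence between two conjugates can be pulled back by the Frobenius to a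
nontrivial period of [xi] itself. *)
Lemma conj_uniq xi : uniq (conjugates xi).
Proof.
rewrite map_inj_in_uniq ?iota_uniq // => i j.
rewrite !mem_iota /= !add0n => ilt jlt eqij.
wlog le_ij : i j ilt jlt eqij / (i <= j)%N.
  by move=> W; case: (leqP i j) => [|/ltnW] le; [|symmetry]; apply: W le.
apply/eqP; rewrite eqn_leq le_ij /= leqNgt; apply/negP => lt_ij.
have := @frob_not_fixed xi (j - i); rewrite subn_gt0 lt_ij.
rewrite (leq_ltn_trans (leq_subr _ _) jlt) => /(_ isT)/eqP; apply.
by apply: (@iter_frob_inj i); rewrite -exprM -expnD subnK // -eqij.
Qed.

Lemma orbit_polyE xi : orbit_poly xi = \prod_(x <- conjugates xi) ('X - x%:P).
Proof.
rewrite /orbit_poly -(big_mkord xpredT (fun i => 'X - (xi ^+ (q ^ i))%:P)).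
by rewrite big_map /index_iota subn0.
Qed.

Lemma size_orbit_poly xi : size (orbit_poly xi) = (conj_degree xi).+1.
Proof. by rewrite orbit_polyE size_prod_XsubC size_map size_iota. Qed.

Lemma orbit_poly_monic xi : orbit_poly xi \is monic.
Proof. exact: monic_prod_XsubC. Qed.

Lemma root_orbit_poly xi x : root (orbit_poly xi) x = (x \in conjugates xi).
Proof. by rewrite orbit_polyE root_prod_XsubC. Qed.

Lemma conj_degree_gt0 xi : (0 < conj_degree xi)%N.
Proof. by rewrite /conj_degree; do 2?case: ifP. Qed.

Lemma conjugates_refl xi : xi \in conjugates xi.
Proof.
apply/mapP; exists 0%N; first by rewrite mem_iota conj_degree_gt0.
by rewrite expn0 expr1.
Qed.

(** The four factors of [conj_poly xi] run [4 / d] times through the [d] distinct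
conjugates of [xi]. *)
Lemma conj_polyE xi : conj_poly xi = orbit_poly xi ^+ (4 %/ conj_degree xi).
Proof.
have := frob_period xi; rewrite /orbit_poly /conj_poly /conj_degree.
do 2?case: ifP => _; rewrite !big_ord_recl !big_ord0 /= ?expn1 /bump /= ?expn0 ?expr1.
- move=> e1; have e2 : xi ^+ (q ^ 2) = xi by rewrite expnSr exprM expn1 e1.
  have e3 : xi ^+ (q ^ 3) = xi by rewrite expnSr exprM e2.
  by rewrite e1 e2 e3; ring.
- move=> e2.
  have e3 : xi ^+ (q ^ 3) = xi ^+ q by rewrite expnSr exprM e2.
  by rewrite e2 e3; ring.
- by [].
Qed.

Lemma root_conj_poly xi x : root (conj_poly xi) x = (x \in conjugates xi).
Proof.
rewrite conj_polyE root_exp ?root_orbit_poly //; first exact: mulrC.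
by rewrite divn_gt0 ?conj_degree_gt0 // dvdn_leq ?conj_degree_dvd.
Qed.

Lemma conj_poly_frob xi : conj_poly (xi ^+ q) = conj_poly xi.
Proof.
rewrite /conj_poly !big_ord_recl !big_ord0 /= /bump /= -!exprM -!expnS.
by rewrite -cardK expf_card expn0 expr1; ring.
Qed.

Lemma conj_poly_iter n xi : conj_poly (xi ^+ (q ^ n)) = conj_poly xi.
Proof.
by elim: n => [|n IH]; rewrite ?expn0 ?expr1 // expnSr exprM conj_poly_frob.
Qed.

Lemma conj_poly_eq xi x : (conj_poly x == conj_poly xi) = (x \in conjugates xi).
Proof.
apply/eqP/idP => [e|/mapP[i _ ->]]; last exact: conj_poly_iter.
by rewrite -root_conj_poly -e root_conj_poly conjugates_refl.
Qed.

Lemma map_frob_prod (s : seq K) :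
  map_poly (frob emb) (\prod_(x <- s) ('X - x%:P)) = \prod_(x <- s) ('X - (x ^+ q)%:P).
Proof.
rewrite rmorph_prod /=; apply: eq_bigr => x _.
by rewrite rmorphB /= map_polyX map_polyC.
Qed.

Lemma orbit_poly_descent xi : exists r, orbit_poly xi = map_poly emb r.
Proof.
apply: poly_descent; rewrite [in LHS]orbit_polyE map_frob_prod /orbit_poly.
rewrite big_map -[X in iota 0 X]subn0 -/(index_iota 0 _) big_mkord.
have [d dE] : exists d, conj_degree xi = d.+1.
  by exists (conj_degree xi).-1; rewrite prednK ?conj_degree_gt0.
have := frob_period xi; rewrite dE => per.
rewrite big_ord_recr [RHS]big_ord_recl /= expn0 expr1 mulrC.
rewrite -exprM -expnSr per; congr (_ * _).
by apply: eq_bigr => i _; rewrite -exprM -expnSr.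
Qed.

Lemma root_frob (p : {poly F}) n x :
  root (map_poly emb p) x -> root (map_poly emb p) (x ^+ (q ^ n)).
Proof.
elim: n => [|n IH] rx; first by rewrite expn0 expr1.
rewrite expnSr exprM -/(frob emb _).
have -> : map_poly emb p = map_poly (frob emb) (map_poly emb p).
  by apply/polyP=> i; rewrite !coef_map /= frob_emb.
exact/(rmorph_root (frob emb))/IH.
Qed.

Lemma orbit_poly_dvd (p : {poly F}) xi :
  root (map_poly emb p) xi -> orbit_poly xi %| map_poly emb p.
Proof.
move=> rx; rewrite orbit_polyE uniq_roots_dvdp ?uniq_rootsE ?conj_uniq //.
by apply/allP=> y /mapP[i _ ->]; apply: root_frob.
Qed.

(** A factor over [F] with one root in the orbit has all of them, by [root_frob]. *)
Lemma orbit_poly_irreducible xi (p : {poly F}) :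
  orbit_poly xi = map_poly emb p -> irreducible_poly p.
Proof.
move=> pE; have sp : size p = (conj_degree xi).+1.
  by rewrite -size_orbit_poly pE size_map_poly.
split=> [|r r_neq1 r_dv]; first by rewrite sp ltnS conj_degree_gt0.
have [r0|r_gt1|r1] := ltngtP (size r) 1; last by rewrite r1 in r_neq1.
  move: r0 r_dv; rewrite ltnS leqn0 size_poly_eq0 => /eqP-> /[!dvd0p]/eqP p0.
  by rewrite p0 size_poly0 in sp.
have r_dvK : map_poly emb r %| orbit_poly xi by rewrite pE dvdp_map.
have [x x_c rx] : exists2 x, x \in conjugates xi & root (map_poly emb r) x.
  have := r_dvK; rewrite orbit_polyE => /dvdp_prod_XsubC[m Em].
  have: size (map_poly emb r) = (size (mask m (conjugates xi))).+1.
    by rewrite (eqp_size Em) size_prod_XsubC.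
  rewrite size_map_poly; case Ems: (mask m _) => [|x s] sr.
    by rewrite sr in r_gt1.
  exists x; first by apply: (@mem_mask _ _ m); rewrite Ems mem_head.
  by rewrite (eqp_root Em) root_prod_XsubC Ems mem_head.
have rxi : root (map_poly emb r) xi.
  case/mapP: x_c => i; rewrite mem_iota add0n => /= ilt xE.
  move: rx => /(root_frob (conj_degree xi - i)); rewrite xE -exprM -expnD.
  by rewrite subnKC ?frob_period // ltnW.
rewrite /eqp r_dv /= -(dvdp_map emb) -pE; exact: orbit_poly_dvd.
Qed.

(** In the extension obtained by adjoining a root [z] of [p] one has [z^(q^4) = z], so [p]
divides [X^(q^4) - X], which splits over [K]. *)
Lemma irreducible_root (p : {poly F}) :
  irreducible_poly p -> ((size p).-1 %| 4)%N ->
  exists x, root (map_poly emb p) x.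
Proof.
move=> p_irr dv4; have [M dimM [z rz _]] := irredp_FAdjoin p_irr.
have p_gt1 := p_irr.1.
have zq : z ^+ (q ^ (size p).-1) = z.
  have := Fermat's_little_theorem {:M}%AS z.
  by rewrite memvf dimM => /esym/eqP.
have zq4 : z ^+ (q ^ 4) = z.
  case/dvdnP: dv4 => e ->; elim: e => [|e IH]; first by rewrite expr1.
  by rewrite mulSn expnD exprM zq.
have p_dv : p %| 'X^(q ^ 4) - 'X.
  apply/negPn; rewrite -irreducible_poly_coprime // -(coprimep_map (in_alg M)).
  apply/negP => /coprimep_root /(_ rz) /negP; apply.
  by rewrite rmorphB /= map_polyXn map_polyX !hornerE zq4 subrr.
move: p_dv; rewrite -(dvdp_map emb) rmorphB /= map_polyXn map_polyX -cardK.
rewrite finField_genPoly -big_enum => /dvdp_prod_XsubC[m Em].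
have: size (map_poly emb p) = (size (mask m (enum K))).+1.
  by rewrite (eqp_size Em) size_prod_XsubC.
rewrite size_map_poly; case: (mask m _) Em => [|x s] Em sp.
  by rewrite sp in p_gt1.
by exists x; rewrite (eqp_root Em) root_prod_XsubC mem_head.
Qed.

(** This is the converse of [conj_polyE]: it makes the vanishing clause of the
character formula a consequence of the sum in [cusp_value] being empty. *)
Lemma primary_conj_poly (P p : {poly F}) e :
  irreducible_poly p -> ((size p).-1 %| 4)%N -> P = p ^+ e ->
  P \is monic -> size P = 5%N ->
  exists xi, map_poly emb P = conj_poly xi.
Proof.
move=> p_irr p_dv PE P_monic sP.
have [xi rxi] := irreducible_root p_irr p_dv; exists xi.
have [r rE] := orbit_poly_descent xi.
have r_irr := orbit_poly_irreducible rE.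
have pr : p %= r.
  rewrite eqp_sym; apply: p_irr.2; first by rewrite gtn_eqF ?r_irr.1.
  by rewrite -(dvdp_map emb) -rE orbit_poly_dvd.
have r_monic : r \is monic by rewrite -(map_monic emb) -rE orbit_poly_monic.
have PrE : P = r ^+ e.
  have PZ : P = (lead_coef p / lead_coef r) ^+ e *: r ^+ e.
    by rewrite PE {1}(eqpfP pr) exprZn.
  have /monicP := P_monic; rewrite PZ lead_coefZ (monicP (monic_exp e r_monic)).
  by rewrite mulr1 => ->; rewrite scale1r.
have sr : size r = (conj_degree xi).+1 by rewrite -size_orbit_poly rE size_map_poly.
have de : (conj_degree xi * e = 4)%N.
  by have := size_exp r e; rewrite -PrE sP sr /= => <-.
rewrite PrE rmorphXn /= -rE conj_polyE -de mulKn //; exact: conj_degree_gt0.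
Qed.

End DegreeFour.
End FrobMorphism.

(** * The character as a sum over eigenvalues *)

Section ConjugationInvariance.

Variables (F K : finFieldType) (emb : {rmorphism F -> K}).
Local Notation q := #|F|.

Lemma conj_degree_iter n (x : K) : conj_degree F (x ^+ (q ^ n)) = conj_degree F x.
Proof.
rewrite /conj_degree (exprAC _ _ q) (exprAC _ _ (q ^ 2)).
by rewrite !(inj_eq (iter_frob_inj emb (n := n))).
Qed.

Lemma rank_conj m (g : 'M[F]_m) n (x : K) :
  \rank (kermx (map_mx emb g - (x ^+ (q ^ n))%:M))
    = \rank (kermx (map_mx emb g - x%:M)).
Proof.
elim: n => [|n IH]; first by rewrite expn0 expr1.
have fixG : map_mx (frob emb) (map_mx emb g) = map_mx emb g.
  by apply/matrixP => i j; rewrite !mxE /= frob_emb.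
rewrite -[RHS]IH -[RHS](mxrank_map (frob emb)) map_kermx map_mxB fixG map_scalar_mx.
by rewrite /= /frob -exprM -expnSr.
Qed.

(** A left kernel; its dimension is also that of the right eigenspace. *)
Definition geom_mult (g : 'M[F]_4) (x : K) : nat := \rank (kermx (map_mx emb g - x%:M)).

(** The two clauses of the character formula in one expression.  If the
characteristic polynomial of [g] is a power of an irreducible polynomial, the sum
runs over its roots, which all have the same degree and multiplicity; otherwise it
is empty. *)
Definition cusp_value (C : numClosedFieldType) (theta : K -> C) (g : 'M[F]_4) : C :=
  - \sum_(x : K | map_poly emb (char_poly g) == conj_poly F x)
      theta x * \prod_(1 <= j < geom_mult g x) (1 - q%:R ^+ (conj_degree F x * j)).

Lemma geom_mult_iter g n x : geom_mult g (x ^+ (q ^ n)) = geom_mult g x.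
Proof. exact: rank_conj. Qed.

End ConjugationInvariance.

Section CharacterFormula.

Variables (F : finFieldType) (C : numClosedFieldType).
Variables (L : fieldExtType F) (dimL : \dim {:L} = 4%N).
Variables (E2 : {subfield L}) (dimE2 : \dim E2 = 2%N).
Local Notation K := (finvect_type L).
Local Notation q := #|F|.
Local Notation emb := (in_alg K : {rmorphism F -> K}).

Lemma card_ext : #|K| = (q ^ 4)%N.
Proof.
rewrite -dimL -(@card_vspace F K (Vector.class _) {:K}%VS).
exact/esym/(@card_vspacef F K).
Qed.

Lemma subfield_of_degree (x : K) :
  exists E : {subfield L}, \dim E = conj_degree F x /\ (x : L) \in E.
Proof.
rewrite /conj_degree; case: eqP => [e1|_]; last case: eqP => [e2|_].
- exists 1%AS; rewrite dimv1; split=> //.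
  by rewrite Fermat's_little_theorem dimv1 expn1; apply/eqP.
- exists E2; rewrite dimE2; split=> //.
  by rewrite Fermat's_little_theorem dimE2; apply/eqP.
- by exists {:L}%AS; rewrite dimL memvf.
Qed.

Variables (d : nat) (pi : mx_representation C 'GL_4[F] d).
Variables (theta : L -> C) (pi_theta : associated pi theta).

Lemma character_formula (g : {'GL_4[F]}) :
  \tr (pi g) = cusp_value emb theta (GLval g).
Proof.
rewrite /cusp_value; have [fnull fval] := pi_theta g.
set P := char_poly _ in fnull fval *.
have P_monic : P \is monic := char_poly_monic _.
have sP : size P = 5%N := size_char_poly _.
case: (pickP (fun x : K => map_poly emb P == conj_poly F x)) => [x /eqP Hx|none].
- have [E [dimE xE]] := subfield_of_degree x.
  have [p pE] := orbit_poly_descent emb card_ext x.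
  have p_irr := orbit_poly_irreducible card_ext pE.
  have sp : (size p).-1 = conj_degree F x.
    by rewrite -(size_map_poly emb) -pE size_orbit_poly.
  have PE : P = p ^+ (4 %/ conj_degree F x).
    apply: (map_poly_inj emb); rewrite Hx (conj_polyE card_ext) pE.
    by rewrite rmorphXn.
  pose a := Subvs xE; have aE : vsval a = x by [].
  have dv : ((size p).-1 %| 4)%N by rewrite sp conj_degree_dvd.
  have := fval p _ E a p_irr dv PE _ _; rewrite sp dimE => /(_ erefl).
  have gEmap : map_mx vsval (map_mx (in_alg (subvs_of E)) (GLval g))
             = map_mx (in_alg L) (GLval g).
    by apply/matrixP=> i j; rewrite !mxE /= algid1.
  have rooted : eigenvalue (map_mx (in_alg (subvs_of E)) (GLval g)) a.
    rewrite eigenvalue_root_char -(fmorph_root (vsval : {rmorphism subvs_of E -> L})).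
    rewrite map_char_poly /= gEmap.
    have -> : root (char_poly (map_mx (in_alg L) (GLval g))) x = root (map_poly emb P) x.
      by rewrite map_char_poly.
    by rewrite Hx root_conj_poly ?conjugates_refl //; apply: card_ext.
  move=> /(_ rooted) ->.
  have kE : \rank (kermx (map_mx (in_alg (subvs_of E)) (GLval g) - a%:M))
          = geom_mult emb (GLval g) x.
    rewrite -(mxrank_map (vsval : {rmorphism subvs_of E -> L})) map_kermx map_mxB /=.
    by rewrite gEmap map_scalar_mx.
  rewrite kE -signr_odd expr1 mulN1r mulNr; congr (- _).
  have key (y : K) : (map_poly emb P == conj_poly F y) = (y \in conjugates F x).
    by rewrite Hx eq_sym (conj_poly_eq card_ext).
  rewrite (eq_bigl _ _ key).
  rewrite -big_uniq ?(conj_uniq emb) //=; last exact: card_ext.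
  rewrite big_map -[X in iota 0 X]subn0 -/(index_iota 0 _) big_mkord mulr_suml.
  apply: eq_bigr => i _.
  by rewrite (conj_degree_iter emb i x) (geom_mult_iter emb (GLval g) i x).
(* without a match, the characteristic polynomial is no power of an irreducible
   polynomial whose degree divides 4 *)
rewrite fnull ?big_pred0 ?oppr0 // => -[p [e [p_irr p_dv pE]]].
have [x xE] := primary_conj_poly emb card_ext p_irr p_dv pE P_monic sP.
by have := none x; rewrite xE eqxx.
Qed.

End CharacterFormula.

(** * Summing the character over unipotent matrices *)

Section AdditiveCharacter.

Variable C : numClosedFieldType.

(** Translating the variable by an element where [f] is not 1 multiplies the sum by
a factor different from 1. *)
Lemma sum_character_eq0 (V : finZmodType) (f : V -> C) :
  (forall x y, f (x + y) = f x * f y) -> (exists x, f x != 1) -> \sum_x f x = 0.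
Proof.
move=> fD [a fa]; apply/eqP; have : (1 - f a) * \sum_x f x == 0.
  rewrite mulrBl mul1r subr_eq0 mulr_sumr (reindex_inj (addrI a)) /=.
  by apply/eqP; apply: eq_bigr => x _.
by rewrite mulf_eq0 subr_eq0 eq_sym (negPf fa).
Qed.

Variables (F : finFieldType) (psi : F -> C) (psi_char : additive_char psi).

Lemma psi0 : psi 0 = 1. Proof. exact: psi_char.1. Qed.
Lemma psiD x y : psi (x + y) = psi x * psi y. Proof. exact: psi_char.2. Qed.
Lemma psi_neq0 x : psi x != 0.
Proof.
apply/eqP=> e0; have := psiD x (- x); rewrite subrr psi0 e0 mul0r => /eqP.
by rewrite oner_eq0.
Qed.
Lemma psiN x : psi (- x) = (psi x)^-1.
Proof. by apply: (mulfI (psi_neq0 x)); rewrite -psiD subrr psi0 mulfV ?psi_neq0. Qed.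

End AdditiveCharacter.

Section StrictUpper.

Variables (F : finFieldType) (C : numClosedFieldType).
Local Notation q := #|F|.

Lemma card_rowspace m n (A : 'M[F]_(m, n)) :
  #|[set r : 'rV[F]_n | (r <= A)%MS]| = (q ^ \rank A)%N.
Proof.
have inj : injective (fun w : 'rV_(\rank A) => w *m row_base A).
  by apply: row_free_inj; apply: row_base_free.
have <- : #|[set w *m row_base A | w in [set: 'rV[F]_(\rank A)]]| = (q ^ \rank A)%N.
  by rewrite card_imset // cardsT card_mx mul1n.
apply: eq_card => r; rewrite !inE -(eq_row_base A).
apply/submxP/imsetP => [[w ->]|[w _ ->]]; first by exists w; rewrite ?inE.
by exists w.
Qed.

Definition strict_upper n (T : 'M[F]_n) : bool :=
  [forall i : 'I_n, forall j : 'I_n, (j <= i)%N ==> (T i j == 0)].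

Definition superdiag n (T : 'M[F]_n) : F :=
  \sum_(i < n) \sum_(j < n | j == i.+1 :> nat) T i j.

Lemma strict_upperP n (T : 'M[F]_n) :
  reflect (forall i j : 'I_n, (j <= i)%N -> T i j = 0) (strict_upper T).
Proof.
apply: (iffP forallP) => [H i j le|H i].
  by have /forallP/(_ j)/implyP/(_ le)/eqP := H i.
by apply/forallP=> j; apply/implyP=> le; apply/eqP/H.
Qed.

Lemma strict_upper_block n (r : 'rV[F]_n) (T : 'M[F]_n) :
  strict_upper (block_mx (0 : 'M_1) r 0 T) = strict_upper T.
Proof.
apply/strict_upperP/strict_upperP => H i j le.
  by have := H (rshift 1 i) (rshift 1 j); rewrite block_mxEdr; apply.
case: (split_ordP i) le => i0 ->; case: (split_ordP j) => j0 -> le.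
- by rewrite block_mxEul mxE.
- by move: le; rewrite /= (ord1 i0).
- by rewrite block_mxEdl mxE.
by rewrite block_mxEdr H.
Qed.

Lemma superdiag_block n (r : 'rV[F]_n.+1) (T : 'M[F]_n.+1) :
  superdiag (block_mx (0 : 'M_1) r 0 T) = r 0 0 + superdiag T.
Proof.
rewrite /superdiag big_split_ord /= big_ord1; congr (_ + _).
  rewrite (bigD1 (rshift 1 0)) //= block_mxEur big1 ?addr0 // => j /andP[/eqP je].
  by case/eqP; apply/val_inj; rewrite /= je.
apply: eq_bigr => i _; rewrite big_split_ord /= big1 ?add0r.
  by apply: eq_big => [j|j _]; rewrite ?block_mxEdr // !add1n eqSS.
by move=> j; rewrite (ord1 j).
Qed.

Lemma sum_strict_upper n (f : 'M[F]_(1 + n) -> C) :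
  \sum_(T | strict_upper T) f T
  = \sum_(T : 'M[F]_n | strict_upper T) \sum_(r : 'rV[F]_n) f (block_mx (0 : 'M_1) r 0 T).
Proof.
rewrite pair_big_dep /=.
rewrite (reindex_onto (fun p : 'M[F]_n * 'rV[F]_n => block_mx (0 : 'M_1) p.2 0 p.1)
  (fun T => (drsubmx T, ursubmx T))) /=.
  apply: eq_bigl => -[T r] /=.
  by rewrite strict_upper_block block_mxKur block_mxKdr eqxx !andbT.
move=> T /strict_upperP H; rewrite -[RHS]submxK; congr (block_mx _ _ _ _).
  by apply/matrixP=> i j; rewrite !mxE H //= (ord1 i) (ord1 j).
by apply/matrixP=> i j; rewrite !mxE H //= (ord1 j).
Qed.

Lemma strict_upper_col0 n m (A : 'M[F]_(m, n.+1)) (T : 'M[F]_n.+1) i :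
  strict_upper T -> (A <= T)%MS -> A i 0 = 0.
Proof.
move=> /strict_upperP H /submxP[D ->]; rewrite mxE big1 // => k _.
by rewrite H // mulr0.
Qed.

Lemma strict_upper_rank n (T : 'M[F]_n.+1) : strict_upper T -> (\rank T <= n)%N.
Proof.
move=> uT; rewrite -ltnS ltn_neqAle rank_leq_row andbT.
apply/negP => fullT; have := @strict_upper_col0 _ _ (1%:M) T 0 uT.
by rewrite submx_full // mxE eqxx => /(_ isT)/eqP; rewrite oner_eq0.
Qed.

(** Together with [card_rowspace], this gives the distribution of the rank when a
row is added at random. *)
Lemma rank_add_row m n (r : 'rV[F]_n) (A : 'M[F]_(m, n)) :
  \rank (col_mx r A) = if (r <= A)%MS then \rank A else (\rank A).+1.
Proof.
rewrite -(addsmxE r A); case: ifP => [/addsmx_idPr -> //|nsub].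
apply/eqP; rewrite eqn_leq; apply/andP; split.
  by rewrite (leq_trans (mxrank_adds_leqif _ _).1) // -(add1n (\rank A)) leq_add2r rank_leq_row.
apply: rank_ltmx; rewrite ltmxE addsmxSr /=; apply/negP => /(submx_trans (addsmxSl _ _)).
by rewrite nsub.
Qed.

(** Up to the sign, the value of a cuspidal character of GL_n at a unipotent [u] with
[u - 1] of rank [k]. *)
Definition unip_value n k : C := \prod_(1 <= j < n - k) (1 - q%:R ^+ j).

Variables (psi : F -> C) (psi_char : additive_char psi).
Hypothesis psi_nontriv : exists x, psi x != 1.

(** Add a first row [r] to a strictly upper triangular matrix [T] of rank [rho].  As the
first column of [T] is zero, [psi] is trivial on the rows in the row space of [T],
so the sum over [r] leaves only [q^rho] times the difference of the values at ranks
[rho] and [rho + 1], and that difference is [- q^(n + 1 - rho)] times the value at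
rank [rho + 1]. *)
Lemma unipotent_sumS n :
  \sum_(T : 'M[F]_(1 + n.+1) | strict_upper T)
     psi (- superdiag T) * unip_value (1 + n.+1) (\rank T)
  = - q%:R ^+ n.+1 * \sum_(T : 'M[F]_n.+1 | strict_upper T)
     psi (- superdiag T) * unip_value n.+1 (\rank T).
Proof.
rewrite sum_strict_upper mulr_sumr; apply: eq_bigr => T uT.
set rho := \rank T.
have le_rho : (rho <= n)%N := strict_upper_rank uT.
pose u := unip_value n.+2 rho; pose v := unip_value n.+2 rho.+1.
have term r : psi (- superdiag (block_mx (0 : 'M_1) r 0 T)) *
      unip_value (1 + n.+1) (\rank (block_mx (0 : 'M_1) r 0 T))
   = psi (- superdiag T) * ((if (r <= T)%MS then u - v else 0) + psi (- r 0 0) * v).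
  rewrite superdiag_block opprD (psiD psi_char) [_ * psi (- superdiag T)]mulrC -mulrA.
  congr (_ * _).
  have -> : \rank (block_mx (0 : 'M_1) r 0 T) = \rank (col_mx r T).
    by rewrite block_mxEh col_mx0 rank_row_0mx.
  rewrite rank_add_row; case: ifP => [rT|_]; last by rewrite add0r.
  by rewrite (strict_upper_col0 0 uT rT) oppr0 (psi0 psi_char) !mul1r subrK.
rewrite (eq_bigr _ (fun r _ => term r)) -mulr_sumr big_split /= -mulr_suml.
have -> : \sum_(r : 'rV[F]_n.+1) psi (- r 0 0) = 0.
  apply: (sum_character_eq0 (f := fun r : 'rV[F]_n.+1 => psi (- r 0 0))) => [r s|].
    by rewrite mxE opprD psiD.
  have [x hx] := psi_nontriv; exists (const_mx (- x)).
  by rewrite mxE opprK.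
rewrite mul0r addr0 -big_mkcond /= sumr_const.
have -> : #|[pred r : 'rV[F]_n.+1 | (r <= T)%MS]| = (q ^ rho)%N.
  by rewrite -card_rowspace; apply: eq_card => r; rewrite !inE.
have uE : u = v * (1 - q%:R ^+ (n.+1 - rho)).
  rewrite /u /v /unip_value subSS (subSn (leqW le_rho)) big_nat_recr //.
  by rewrite subn_gt0.
have vE : unip_value n.+1 rho = v by rewrite /v /unip_value subSS.
have qE : q%:R ^+ n.+1 = q%:R ^+ rho * q%:R ^+ (n.+1 - rho) :> C.
  by rewrite -exprD subnKC // leqW.
by rewrite vE uE qE -[_ *+ (q ^ rho)]mulr_natl natrX; ring.
Qed.

Lemma unipotent_sum1 :
  \sum_(T : 'M[F]_1 | strict_upper T) psi (- superdiag T) * unip_value 1 (\rank T) = 1.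
Proof.
rewrite (big_pred1 0) => [|T].
  rewrite /superdiag big_ord1 big1 => [|j]; last by rewrite (ord1 j).
  by rewrite oppr0 (psi0 psi_char) mul1r mxrank0 /unip_value big_geq.
apply/strict_upperP/eqP => [H|-> i j _]; last by rewrite mxE.
by apply/matrixP=> i j; rewrite mxE (ord1 i) (ord1 j) H.
Qed.

Lemma unipotent_sum4 :
  \sum_(T : 'M[F]_4 | strict_upper T) psi (- superdiag T) * unip_value 4 (\rank T)
  = - q%:R ^+ 6.
Proof. by rewrite !unipotent_sumS unipotent_sum1; ring. Qed.

End StrictUpper.

(** * Block companion matrices *)

Section BlockCompanion.

Let blockE := (mulmx1, mul1mx, mulmx0, mul0mx, mulNmx, mulmxN, add0r, addr0,
  oppr0, @opprK, addNr, subrr).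

Lemma det_block_swap (R : comNzRingType) n :
  \det (block_mx 0 (- 1%:M) 1%:M 0 : 'M[R]_(n + n)) = 1.
Proof.
have <- : block_mx 1%:M (- 1%:M) 0 1%:M *m block_mx 1%:M 0 1%:M 1%:M
          *m block_mx 1%:M (- 1%:M) 0 1%:M
        = block_mx 0 (- 1%:M) 1%:M 0 :> 'M[R]_(n + n).
  by rewrite !(mulmx_block, blockE).
by rewrite !det_mulmx !det_ublock det_lblock !det1 !mul1r.
Qed.

(** Column operations by unimodular block matrices make the matrix block
triangular. *)
Lemma det_companion (R : comNzRingType) n (x : R) (P Q : 'M[R]_n) :
  \det (block_mx x%:M (- Q) (- 1%:M) P) = \det (x *: P - Q).
Proof.
have E : block_mx x%:M (- Q) (- 1%:M) P *m (block_mx 1%:M P 0 1%:M *m block_mx 0 (- 1%:M) 1%:M 0)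
       = block_mx (x *: P - Q) (- x%:M) 0 1%:M.
  by rewrite !(mulmx_block, blockE, mul_scalar_mx) scalerN scalemx1.
have := congr1 determinant E.
by rewrite !det_mulmx !det_ublock det_block_swap !det1 !mulr1.
Qed.

Lemma char_poly_companion (R : comNzRingType) n (Q Z : 'M[R]_n) :
  char_poly (block_mx 0 Q 1%:M Z)
  = \det ('X *: ('X%:M - map_mx polyC Z) - map_mx polyC Q).
Proof.
rewrite -det_companion /char_poly /char_poly_mx; congr (\det _).
rewrite map_block_mx scalar_mx_block opp_block_mx add_block_mx.
by rewrite map_scalar_mx /= map_mx0 oppr0 addr0 !sub0r.
Qed.

(** Block elimination: eigenvectors of the block companion matrix correspond to null
vectors of the quadratic matrix pencil [x (x - Z) - Q]. *)
Lemma rank_companion (K : fieldType) n (x : K) (Q Z : 'M[K]_n) :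
  \rank (block_mx 0 Q 1%:M Z - x%:M) = (n + \rank (x *: (x%:M - Z) - Q)%R)%N.
Proof.
set P := _ - Q.
pose U := block_mx 1%:M x%:M 0 1%:M : 'M[K]_(n + n).
pose V := block_mx (x%:M - Z) 1%:M 1%:M 0.
have VV' : V *m block_mx 0 1%:M 1%:M (Z - x%:M) = 1%:M.
  rewrite mulmx_block !mulmx1 !mul1mx !mul0mx mulmx0 !addr0 !add0r.
  by rewrite addrC subrKA @subrr -scalar_mx_block.
have U_free : row_full U.
  by rewrite row_full_unit unitmxE det_ublock !det1 mulr1 unitr1.
have V_free : row_free V.
  by rewrite row_free_unit; case: (mulmx1_unit VV').
have E : U *m (block_mx 0 Q 1%:M Z - x%:M) *m V = block_mx (- P) 0 0 1%:M.
  rewrite scalar_mx_block opp_block_mx add_block_mx sub0r oppr0 !addr0.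
  rewrite !mulmx_block !mulmx1 !mul1mx !mul0mx !mulmx0 !addr0 !add0r.
  rewrite mul_scalar_mx addNr mul0mx add0r -/P; congr (block_mx _ _ _ _).
    by rewrite mul_scalar_mx /P opprB -scalerN opprB.
  by rewrite scale1r -(opprB Z) addNr.
rewrite -(eqmxMfull _ U_free) -(mxrankMfree _ V_free) E.
by rewrite rank_diag_block_mx mxrank_opp mxrank1 addnC.
Qed.

End BlockCompanion.

(** * Two by two matrices and quartic polynomials *)

Section TwoByTwo.

Variable R : comNzRingType.
Implicit Types a b c d : R.

Definition mx2 a b c d : 'M[R]_2 :=
  \matrix_(i, j) if i == 0 then if j == 0 then a else b else if j == 0 then c else d.

Lemma mx2_eta (A : 'M[R]_2) : A = mx2 (A 0 0) (A 0 1) (A 1 0) (A 1 1).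
Proof.
apply/matrixP => i j; rewrite !mxE.
by case: i => [[|[|//]] ?]; case: j => [[|[|//]] ?] /=; congr (A _ _); apply/val_inj.
Qed.

Lemma mx2_inj a b c d a' b' c' d' :
  mx2 a b c d = mx2 a' b' c' d' -> [/\ a = a', b = b', c = c' & d = d'].
Proof.
move/matrixP=> E; split; [have := E 0 0|have := E 0 1|have := E 1 0|have := E 1 1];
by rewrite !mxE.
Qed.

Lemma mx2D a b c d a' b' c' d' :
  mx2 a b c d + mx2 a' b' c' d' = mx2 (a + a') (b + b') (c + c') (d + d').
Proof. by apply/matrixP=> i j; rewrite !mxE; do 2?case: ifP. Qed.

Lemma mx2N a b c d : - mx2 a b c d = mx2 (- a) (- b) (- c) (- d).
Proof. by apply/matrixP=> i j; rewrite !mxE; do 2?case: ifP. Qed.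

Lemma mx2Z x a b c d : x *: mx2 a b c d = mx2 (x * a) (x * b) (x * c) (x * d).
Proof. by apply/matrixP=> i j; rewrite !mxE; do 2?case: ifP. Qed.

Lemma mx2M a b c d a' b' c' d' :
  mx2 a b c d *m mx2 a' b' c' d'
  = mx2 (a * a' + b * c') (a * b' + b * d') (c * a' + d * c') (c * b' + d * d').
Proof.
apply/matrixP=> i j; rewrite !mxE !big_ord_recl big_ord0 !mxE /=.
by case: ifP => _; case: ifP => _; rewrite addr0.
Qed.

Lemma mx2_scalar a : a%:M = mx2 a 0 0 a.
Proof.
apply/matrixP => i j; rewrite !mxE.
by case: i => [[|[|//]] ?]; case: j => [[|[|//]] ?].
Qed.

Lemma mx2_0 : 0 = mx2 0 0 0 0.
Proof. by apply/matrixP=> i j; rewrite !mxE; do 2?case: ifP. Qed.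

Lemma mx2_tr a b c d : (mx2 a b c d)^T = mx2 a c b d.
Proof. by apply/matrixP=> i j; rewrite !mxE; do 2?case: ifP. Qed.

Lemma det_mx2 a b c d : \det (mx2 a b c d) = a * d - b * c.
Proof.
rewrite (expand_det_row _ 0) !big_ord_recl big_ord0 /cofactor !det_mx11 !mxE /=.
by rewrite expr0 expr1 mul1r mulN1r addr0 mulrN.
Qed.

Lemma trace_mx2 a b c d : \tr (mx2 a b c d) = a + d.
Proof. by rewrite /mxtrace !big_ord_recl big_ord0 !mxE addr0. Qed.

End TwoByTwo.

Lemma map_mx2 (R S : comNzRingType) (f : R -> S) a b c d :
  map_mx f (mx2 a b c d) = mx2 (f a) (f b) (f c) (f d).
Proof. by apply/matrixP=> i j; rewrite !mxE; do 2?case: ifP. Qed.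

Definition mx2E := (mx2M, mx2D, mx2N, mx2Z, map_mx2, mx2_scalar).

(** The lower left entry is summed first: it is the one on which the later
evaluations split into cases. *)
Lemma sum_mx2 (R : finComNzRingType) (C : nmodType) (f : 'M[R]_2 -> C) :
  \sum_A f A = \sum_c \sum_a \sum_b \sum_d f (mx2 a b c d).
Proof.
rewrite pair_bigA pair_bigA pair_bigA /=.
rewrite (reindex (fun p : R * R * R * R => mx2 p.1.1.2 p.1.2 p.1.1.1 p.2)) //=.
exists (fun A => (A 1 0, A 0 0, A 0 1, A 1 1)) => [[[[c a] b] d]|A] _ /=.
  by rewrite !mxE.
by rewrite [RHS]mx2_eta.
Qed.

Section Quartic.

(** The signs make the coefficients the elementary symmetric functions of the roots. *)
Definition quartic (R : comNzRingType) (c1 c2 c3 c4 : R) : {poly R} :=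
  'X^4 - c1%:P * 'X^3 + c2%:P * 'X^2 - c3%:P * 'X + c4%:P.

Lemma quartic_inj (R : comNzRingType) (a1 a2 a3 a4 b1 b2 b3 b4 : R) :
  quartic a1 a2 a3 a4 = quartic b1 b2 b3 b4 -> [/\ a1 = b1, a2 = b2, a3 = b3 & a4 = b4].
Proof.
move/polyP=> E; split; [have := E 3%N|have := E 2%N|have := E 1%N|have := E 0%N];
rewrite /quartic !(coefD, coefN, coefCM, coefXn, coefX, coefC) /=;
by rewrite !(mulr0, mulr1, addr0, add0r, subr0, sub0r, oppr0) // => /oppr_inj.
Qed.

Lemma map_quartic (R S : comNzRingType) (f : {rmorphism R -> S}) a1 a2 a3 a4 :
  map_poly f (quartic a1 a2 a3 a4) = quartic (f a1) (f a2) (f a3) (f a4).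
Proof.
apply/polyP=> i; rewrite coef_map !(coefD, coefN, coefCM, coefXn, coefX, coefC).
by rewrite /= !(rmorphD, rmorphN, rmorphM, rmorph_nat) (fun_if f) rmorph0.
Qed.

(** Every element of the coset of the antidiagonal matrix [0 t; 1 0] modulo the
unipotent group is conjugate to a matrix of this form. *)
Definition companion (R : comNzRingType) (t s : R) (Z : 'M[R]_2) : 'M[R]_(2 + 2) :=
  block_mx 0 (t *: mx2 1 s 0 1) 1%:M Z.

Lemma char_poly_companion2 (R : comNzRingType) (t s z1 z2 z3 z4 : R) :
  char_poly (companion t s (mx2 z1 z2 z3 z4))
  = quartic (z1 + z4) (z1 * z4 - z2 * z3 - 2 * t) (t * s * z3 - t * (z1 + z4)) (t ^+ 2).
Proof.
rewrite char_poly_companion !mx2E det_mx2 /quartic.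
rewrite !(rmorphD, rmorphB, rmorphM, rmorph0, rmorphXn, rmorph1) /=.
ring.
Qed.

End Quartic.

(** * Counting matrices with a given eigenvalue *)

Section ConjugateInvariants.

Variables (F K : finFieldType) (emb : {rmorphism F -> K}).
Local Notation q := #|F|.
Hypothesis cardK : #|K| = (q ^ 4)%N.
Variables (Tr Nm : K -> F).
Hypothesis TrE : forall x, emb (Tr x) = \sum_(i < 4) x ^+ (q ^ i).
Hypothesis NmE : forall x, emb (Nm x) = \prod_(i < 4) x ^+ (q ^ i).

(** The coefficient of [X] is written with the trace of the inverse, which is what
produces the arguments of the Kloosterman sums. *)
Lemma conj_poly_quartic (x : K) : x != 0 ->
  exists e2, conj_poly F x = map_poly emb (quartic (Tr x) e2 (Nm x * Tr x^-1) (Nm x)).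
Proof.
move=> x0; have [r rE] := orbit_poly_descent emb cardK x.
have RE : conj_poly F x = map_poly emb (r ^+ (4 %/ conj_degree F x)).
  by rewrite (conj_polyE cardK) rE rmorphXn.
exists ((r ^+ (4 %/ conj_degree F x))`_2); rewrite map_quartic.
have e2E : emb (r ^+ (4 %/ conj_degree F x))`_2 = (conj_poly F x)`_2.
  by rewrite RE coef_map.
rewrite e2E rmorphM /= !TrE NmE.
have x1 : x ^+ q != 0 by rewrite expf_neq0.
have x2 : x ^+ (q ^ 2) != 0 by rewrite expf_neq0.
have x3 : x ^+ (q ^ 3) != 0 by rewrite expf_neq0.
rewrite /conj_poly !big_ord_recl !big_ord0 /= /bump /= ?addn0 ?add1n expn0 expr1 expn1.
rewrite !exprVn.
move: x1 x2 x3; set y := x ^+ q; set z := x ^+ _; set w := x ^+ _ => y0 z0 w0.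
have E a b c d : ('X - a%:P) * (('X - b%:P) * (('X - c%:P) * (('X - d%:P) * 1)))
  = quartic (a + b + c + d) (a * b + a * c + a * d + b * c + b * d + c * d)
      (a * b * c + a * b * d + a * c * d + b * c * d) (a * b * c * d) :> {poly K}.
  by rewrite /quartic; ring.
rewrite E.
have -> : (quartic (x + y + z + w) (x * y + x * z + x * w + y * z + y * w + z * w)
  (x * y * z + x * y * w + x * z * w + y * z * w) (x * y * z * w))`_2
  = x * y + x * z + x * w + y * z + y * w + z * w.
  rewrite /quartic !(coefD, coefN, coefCM, coefXn, coefX, coefC) /=.
  by ring.
by congr quartic; [ring | field; rewrite x0 y0 z0 w0 | ring].
Qed.

Variables (C : numClosedFieldType) (theta : K -> C).

(** Vanishing of this matrix means that the eigenspace of [x] has dimension 2. *)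
Definition pencil (t s : F) (Z : 'M[F]_2) (x : K) : 'M[K]_2 :=
  x *: (x%:M - map_mx emb Z) - emb t *: mx2 1 (emb s) 0 1.

(** The pencil at an eigenvalue is singular, so the multiplicity is 1 or 2, and it
is 2 exactly when the pencil vanishes. *)
Lemma cusp_value_companion (t s : F) (Z : 'M[F]_2) :
  cusp_value emb theta (companion t s Z)
  = - \sum_(x | map_poly emb (char_poly (companion t s Z)) == conj_poly F x)
      theta x * (1 - (pencil t s Z x == 0)%:R * q%:R ^+ conj_degree F x).
Proof.
rewrite /cusp_value; congr (- _); apply: eq_bigr => x /eqP xE; congr (_ * _).
have mapE : map_mx emb (companion t s Z)
          = block_mx 0 (emb t *: mx2 1 (emb s) 0 1) 1%:M (map_mx emb Z).
  by rewrite /companion map_block_mx !map_mxZ map_mx2 map_mx0 map_mx1 !rmorph0 !rmorph1.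
have rkE : \rank (map_mx emb (companion t s Z) - x%:M) = (2 + \rank (pencil t s Z x))%N.
  by rewrite mapE; apply: rank_companion.
have rk : geom_mult emb (companion t s Z) x = (2 - \rank (pencil t s Z x))%N.
  by rewrite /geom_mult mxrank_ker rkE -[4%N]/(2 + 2)%N subnDl.
have sing : (\rank (pencil t s Z x) < 2)%N.
  have := conjugates_refl F x; rewrite -(root_conj_poly cardK) -xE map_char_poly.
  rewrite -eigenvalue_root_char /eigenvalue /eigenspace -mxrank_eq0 mxrank_ker rkE.
  by rewrite -[4%N]/(2 + 2)%N subnDl subn_eq0 ltnNge negbK.
rewrite rk; case: eqP => [->|/eqP]; rewrite ?mxrank0 -?mxrank_eq0.
  by rewrite big_nat1 muln1 mul1r.
move: sing; case: (\rank _) => [|[|]] // _ _.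
by rewrite big_geq // mul0r subr0.
Qed.

End ConjugateInvariants.

Section BesselSum.

Variables (F K : finFieldType) (emb : {rmorphism F -> K}).
Local Notation q := #|F|.
Hypothesis cardK : #|K| = (q ^ 4)%N.
Variables (Tr Nm : K -> F).
Hypothesis TrE : forall x, emb (Tr x) = \sum_(i < 4) x ^+ (q ^ i).
Hypothesis NmE : forall x, emb (Nm x) = \prod_(i < 4) x ^+ (q ^ i).
Variables (C : numClosedFieldType) (theta : K -> C).
Variables (psi : F -> C) (psi_char : additive_char psi).
Hypothesis psi_nontriv : exists x, psi x != 1.

Definition same_char_poly (t s : F) (Z : 'M[F]_2) (x : K) : bool :=
  map_poly emb (char_poly (companion t s Z)) == conj_poly F x.

Lemma same_char_polyE (t : F) (x : K) : t != 0 -> x != 0 ->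
  exists e2, forall s a b c d,
  same_char_poly t s (mx2 a b c d) x
  = [&& t ^+ 2 == Nm x, d == Tr x - a, s * c == Tr x + t * Tr x^-1
      & b * c == a * (Tr x - a) - 2 * t - e2].
Proof.
move=> t0 x0; have [e2 cE] := conj_poly_quartic cardK TrE NmE x0; exists e2 => s a b c d.
rewrite /same_char_poly cE (inj_eq (map_poly_inj emb)) char_poly_companion2.
apply/eqP/and4P => [/quartic_inj[h1 h2 h3 h4]|[/eqP h4 /eqP h1 /eqP h3 /eqP h2]].
  split; apply/eqP => //.
  - by rewrite -h1; ring.
  - apply: (mulfI t0); transitivity (t * s * c - t * (a + d) + t * (a + d)); first by ring.
    by rewrite h3 -h4 h1; ring.
  - by rewrite -h1 -h2; ring.
congr quartic => //; first by rewrite h1; ring.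
  by rewrite h1 h2; ring.
by rewrite -h4 -mulrA h3 h1; ring.
Qed.

Lemma sum_delta (T : finType) (a : T) (f : T -> C) : \sum_x (x == a)%:R * f x = f a.
Proof.
rewrite (bigD1 a) //= eqxx mul1r big1 ?addr0 // => x /negPf->.
by rewrite mul0r.
Qed.

Lemma sum_psiN : \sum_s psi (- s) = 0.
Proof.
rewrite (sum_character_eq0 (f := fun s => psi (- s))) // => [x y|].
  by rewrite opprD (psiD psi_char).
by have [x hx] := psi_nontriv; exists (- x); rewrite opprK.
Qed.

(** The characteristic polynomial does not involve [s] when the lower left entry [c]
of [Z] is zero, and then the sum over [s] cancels.  When [c <> 0] it determines [s],
the lower right and the upper right entries, and leaves the upper left entry
free; [- c] is the variable of the Kloosterman sum. *)
Lemma sum_same_char_poly (t : F) (x : K) : t != 0 -> x != 0 ->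
  \sum_s \sum_(Z : 'M[F]_2) psi (- s - Z 1 0) * (same_char_poly t s Z x)%:R
  = (t ^+ 2 == Nm x)%:R * (q%:R * kloosterman psi 1 (Tr x + t * Tr x^-1)).
Proof.
move=> t0 x0; have [e2 mE] := same_char_polyE t0 x0.
set k := Tr x + _ in mE *.
under eq_bigr do rewrite sum_mx2.
rewrite exchange_big /= (bigD1 0) //=.
rewrite [X in X + _ = _](_ : _ = 0); last first.
  pose r := \sum_(a : F) \sum_(b : F) \sum_(d : F) [&& t ^+ 2 == Nm x, d == Tr x - a, 0 == k
      & 0 == a * (Tr x - a) - 2 * t - e2]%:R : C.
  transitivity (\sum_s psi (- s) * r); last by rewrite -mulr_suml sum_psiN mul0r.
  apply: eq_bigr => s _; rewrite mulr_sumr; apply: eq_bigr => a _.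
  rewrite mulr_sumr; apply: eq_bigr => b _; rewrite mulr_sumr; apply: eq_bigr => d _.
  by rewrite mE !mxE /= subr0 !mulr0.
rewrite add0r /kloosterman mulr_sumr mulr_sumr [RHS](reindex_inj oppr_inj) /=.
apply: eq_big => [c|c c0]; first by rewrite oppr_eq0.
have Ec u v : (u == v / c) = (u * c == v) by rewrite -(inj_eq (mulIf c0)) divfK.
transitivity (\sum_s (s == k / c)%:R * ((t ^+ 2 == Nm x)%:R * (q%:R * psi (- s - c)))).
  apply: eq_bigr => s _.
  transitivity (\sum_(a : F) (s == k / c)%:R * ((t ^+ 2 == Nm x)%:R * psi (- s - c))).
    apply: eq_bigr => a _.
    transitivity (\sum_(b : F) (b == (a * (Tr x - a) - 2 * t - e2) / c)%:R
        * ((s == k / c)%:R * ((t ^+ 2 == Nm x)%:R * psi (- s - c)))); last exact: sum_delta.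
    apply: eq_bigr => b _.
    transitivity (\sum_(d : F) (d == Tr x - a)%:R *
      ((b == (a * (Tr x - a) - 2 * t - e2) / c)%:R
        * ((s == k / c)%:R * ((t ^+ 2 == Nm x)%:R * psi (- s - c))))); last exact: sum_delta.
    apply: eq_bigr => d _; rewrite mE mxE /= !Ec.
    by rewrite -!mulnb !natrM; ring.
  by rewrite sumr_const -mulr_natl; ring.
rewrite sum_delta; congr (_ * (_ * _)).
by rewrite mul1r invrN mulrN -(psiD psi_char) addrC.
Qed.

(** The element [x] has degree exactly 2 over [F], and its norm down to [F] is [- t]. *)
Definition quadratic_conj (t : F) (x : K) : bool :=
  [&& x ^+ q != x, x ^+ (q ^ 2) == x & x * x ^+ q == - emb t].

Lemma pencil_eq0 (t s a b c d : F) (x : K) : (pencil emb t s (mx2 a b c d) x == 0)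
  = [&& x ^+ 2 - x * emb a == emb t, x * emb b == - emb (t * s), x * emb c == 0
      & x ^+ 2 - x * emb d == emb t].
Proof.
rewrite /pencil !mx2E mx2_0.
apply/eqP/and4P => [/mx2_inj[h1 h2 h3 h4]|[/eqP h1 /eqP h2 /eqP h3 /eqP h4]].
  split; apply/eqP.
  - by apply/eqP; rewrite -subr_eq0 -h1; apply/eqP; ring.
  - by apply/eqP; rewrite -subr_eq0 -oppr_eq0 -h2 rmorphM; apply/eqP; ring.
  - by apply/eqP; rewrite -oppr_eq0 -h3; apply/eqP; ring.
  - by apply/eqP; rewrite -subr_eq0 -h4; apply/eqP; ring.
congr mx2.
- by rewrite -h1; ring.
- by rewrite sub0r mulrN h2 rmorphM; ring.
- by rewrite sub0r mulrN h3; ring.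
- by rewrite -h4; ring.
Qed.

Lemma pencil_emb (t s a b c d e : F) : e != 0 ->
  (pencil emb t s (mx2 a b c d) (emb e) == 0)
  = [&& a == e - t / e, b == - (t * s) / e, c == 0 & d == e - t / e].
Proof.
move=> e0; rewrite pencil_eq0 -!(rmorphXn, rmorphM, rmorphN, rmorphB) /=.
rewrite -(rmorph0 emb) !(inj_eq (fmorph_inj emb)).
have E u : (e ^+ 2 - e * u == t) = (u == e - t / e).
  by apply/eqP/eqP => [<-|->]; field.
rewrite !E mulf_eq0 (negPf e0) /=; congr [&& _, _ & _].
by rewrite -[in RHS](inj_eq (mulfI e0)) [e * (_ / e)]mulrC divfK.
Qed.

(** As [x] is outside [F], the elements 1 and [x] are linearly independent over [F]. *)
Lemma pencil_not_emb (t s a b c d : F) (x : K) : t != 0 -> x ^+ q != x ->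
  (pencil emb t s (mx2 a b c d) x == 0)
  = [&& x ^+ 2 - x * emb a == emb t, b == 0, c == 0, d == a & s == 0].
Proof.
move=> t0 xq; rewrite pencil_eq0.
have x0 : x != 0.
  apply: contraNneq xq => ->; rewrite expr0n.
  by rewrite gtn_eqF // ltnW // finNzRing_gt1.
apply/and4P/and5P => [[h1 h2 /eqP h3 h4]|[h1 /eqP-> /eqP-> /eqP-> /eqP->]]; last first.
  by rewrite !mulr0 !rmorph0 oppr0 mulr0 eqxx.
have b0 : b = 0.
  apply/eqP/negPn/negP => b0; case/eqP: xq.
  have -> : x = emb (- (t * s) / b).
    rewrite rmorphM rmorphN fmorphV -(eqP h2) mulfK //.
    by rewrite fmorph_eq0.
  exact: frob_emb.
split=> //; first exact/eqP.
- by rewrite -(fmorph_eq0 emb) -(inj_eq (mulfI x0)) h3 mulr0.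
- move: h1; rewrite -(eqP h4) => /eqP/addrI/oppr_inj/(mulfI x0)/fmorph_inj->.
  by rewrite eqxx.
move: h2; rewrite b0 rmorph0 mulr0 eq_sym oppr_eq0 fmorph_eq0 mulf_eq0.
by rewrite (negPf t0).
Qed.

Lemma frob_frob (x : K) : (x ^+ q) ^+ q = x ^+ (q ^ 2).
Proof. by rewrite -exprM mulnn. Qed.

(** If [x] is a root of [X^2 - a X - t], the other root is its conjugate [x^q]. *)
Lemma quadratic_root (t : F) (x : K) : x ^+ q != x ->
  exists a0, forall a,
    (x ^+ 2 - x * emb a == emb t) = (a == a0) && quadratic_conj t x.
Proof.
move=> xq; rewrite /quadratic_conj xq /=.
have frobR a : x ^+ 2 - x * emb a = emb t -> (x ^+ q) ^+ 2 - x ^+ q * emb a = emb t.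
  move=> E; have := congr1 (frob emb) E.
  by rewrite rmorphB [_ (x ^+ 2)]rmorphXn rmorphM /= !frob_emb.
have diff a : x ^+ 2 - x * emb a = emb t -> x + x ^+ q = emb a.
  move=> E; have := frobR a E; rewrite -E => /eqP; rewrite -subr_eq0 => /eqP D.
  apply/eqP; rewrite -subr_eq0; apply/eqP; apply: (mulfI (x := x ^+ q - x)).
    by rewrite subr_eq0.
  by rewrite mulr0 -D; ring.
case: (eqVneq (x ^+ (q ^ 2)) x) => [x2|x2] /=; last first.
  exists 0 => a; rewrite andbF; apply/eqP => E; case/eqP: x2.
  have := frob_emb emb a; rewrite -(diff a E) rmorphD /= /frob frob_frob.
  by rewrite [x + _]addrC => /addrI.
have [a0 a0E] : exists a0, x + x ^+ q = emb a0.
  by apply: frob_fixed; rewrite rmorphD /= /frob frob_frob x2 addrC.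
exists a0 => a; apply/eqP/andP => [E|[/eqP-> /eqP h]].
  have aa0 : a = a0 by apply: (fmorph_inj emb); rewrite -(diff a E).
  by rewrite aa0 eqxx -E -(diff a E); split=> //; apply/eqP; ring.
by rewrite -a0E -[RHS]opprK -h; ring.
Qed.

Lemma quadratic_conj_poly (t s a : F) (x : K) : quadratic_conj t x ->
  x ^+ 2 - x * emb a = emb t -> same_char_poly t 0 (mx2 a 0 0 a) x.
Proof.
move=> /and3P[xq /eqP x2 /eqP xN] E; rewrite /same_char_poly char_poly_companion2.
rewrite map_quartic.
have aE : emb a = x + x ^+ q.
  have x0 : x != 0.
    apply: contraNneq xq => ->; rewrite expr0n.
    by rewrite gtn_eqF // ltnW // finNzRing_gt1.
  apply: (mulfI x0); move: E; rewrite -[emb t]opprK -xN => E.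
  by rewrite -(subKr (x ^+ 2) (x * emb a)) E; ring.
have tE : emb t = - (x * x ^+ q) by rewrite xN opprK.
have x3 : x ^+ (q ^ 3) = x ^+ q by rewrite expnSr exprM x2.
rewrite /conj_poly !big_ord_recl !big_ord0 /= /bump /= ?addn0 ?add1n expn0 expr1 expn1 x2 x3.
rewrite !(rmorphB, rmorphD, rmorphM, rmorphXn, rmorph0, rmorphN, rmorph1) /= aE tE /quartic.
rewrite !(rmorphB, rmorphD, rmorphM, rmorphXn, rmorph0, rmorphN, rmorph1) /=.
by apply/eqP; ring.
Qed.

(** For [x] in [F] the conditions fix every entry of [Z] in terms of [s] and leave [s]
free, so the sum over [s] cancels.  For [x] outside [F] they force [s = 0] and
determine [Z]. *)
Lemma sum_same_pencil (t : F) (x : K) : t != 0 -> x != 0 ->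
  \sum_s \sum_(Z : 'M[F]_2) psi (- s - Z 1 0)
     * (same_char_poly t s Z x && (pencil emb t s Z x == 0))%:R
  = (quadratic_conj t x)%:R.
Proof.
move=> t0 x0; under eq_bigr do rewrite sum_mx2.
have [xq|xq] := eqVneq (x ^+ q) x.
  rewrite /quadratic_conj xq eqxx /=.
  have [e xe] := @frob_fixed _ _ emb x xq.
  have e0 : e != 0 by rewrite -(fmorph_eq0 emb) -xe.
  have [e2 mE] := same_char_polyE t0 x0.
  pose z := e - t / e.
  pose r := [&& t ^+ 2 == Nm x, z == Tr x - z, 0 == Tr x + t * Tr x^-1
    & 0 == z * (Tr x - z) - 2 * t - e2]%:R : C.
  transitivity (\sum_s psi (- s) * r); last by rewrite -mulr_suml sum_psiN mul0r.
  apply: eq_bigr => s _.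
  transitivity (\sum_(c : F) (c == 0)%:R * (\sum_(a : F) (a == z)%:R
    * (\sum_(b : F) (b == - (t * s) / e)%:R * (\sum_(d : F) (d == z)%:R
    * (psi (- s - c) * (same_char_poly t s (mx2 a b c d) x)%:R))))).
    apply: eq_bigr => c _; rewrite mulr_sumr; apply: eq_bigr => a _.
    rewrite !mulr_sumr; apply: eq_bigr => b _; rewrite !mulr_sumr; apply: eq_bigr => d _.
    by rewrite xe pencil_emb // mxE /= -!mulnb !natrM; ring.
  by rewrite !sum_delta mE !mulr0 subr0.
have [a0 a0E] := quadratic_root t xq.
transitivity (\sum_(s : F) (s == 0)%:R * (\sum_(c : F) (c == 0)%:R
   * (\sum_(a : F) (a == a0)%:R * (\sum_(b : F) (b == 0)%:R * (\sum_(d : F) (d == a)%:R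
    * (psi (- s - c) * (same_char_poly t s (mx2 a b c d) x && quadratic_conj t x)%:R)))))).
  apply: eq_bigr => s _; rewrite mulr_sumr; apply: eq_bigr => c _.
  rewrite !mulr_sumr; apply: eq_bigr => a _.
  rewrite !mulr_sumr; apply: eq_bigr => b _; rewrite !mulr_sumr; apply: eq_bigr => d _.
  by rewrite pencil_not_emb // a0E mxE /= -!mulnb !natrM; ring.
rewrite !sum_delta subr0 oppr0 (psi0 psi_char) mul1r.
case qc: (quadratic_conj t x); last by rewrite andbF.
rewrite (quadratic_conj_poly (a := a0) 0) //.
by apply/eqP; rewrite a0E eqxx.
Qed.

(** The sum of the character along a coset of the unipotent group, reduced by
conjugation to block companion matrices. *)
Lemma cusp_value_sum (t : F) : t != 0 ->
  \sum_s \sum_(Z : 'M[F]_2) psi (- s - Z 1 0) * cusp_value emb theta (companion t s Z)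
  = - q%:R * (\sum_(x | (x != 0) && (t ^+ 2 == Nm x))
                theta x * kloosterman psi 1 (Tr x + t * Tr x^-1))
    + q%:R ^+ 2 * \sum_(x | quadratic_conj t x) theta x.
Proof.
move=> t0; have sq0 s Z : same_char_poly t s Z 0 = false.
  apply/negP => /eqP E; have := congr1 (fun p : {poly K} => p`_0) E.
  rewrite coef_map /= (mx2_eta Z) char_poly_companion2.
  have -> : (quartic (Z 0 0 + Z 1 1) (Z 0 0 * Z 1 1 - Z 0 1 * Z 1 0 - 2 * t)
    (t * s * Z 1 0 - t * (Z 0 0 + Z 1 1)) (t ^+ 2))`_0 = t ^+ 2.
    by rewrite /quartic !(coefD, coefN, coefCM, coefXn, coefX, coefC) /=; ring.
  have -> : (conj_poly F (0 : K))`_0 = 0.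
    rewrite -horner_coef0; apply/eqP.
    by rewrite -/(root _ _) (root_conj_poly cardK) conjugates_refl.
  by move/eqP; rewrite fmorph_eq0 expf_eq0 (negPf t0).
transitivity (\sum_(x : K | x != 0) theta x * (- ((t ^+ 2 == Nm x)%:R
     * (q%:R * kloosterman psi 1 (Tr x + t * Tr x^-1)))
     + (quadratic_conj t x)%:R * q%:R ^+ 2)).
  transitivity (\sum_(x : K | x != 0) \sum_s \sum_(Z : 'M[F]_2) theta x *
     (- (psi (- s - Z 1 0) * (same_char_poly t s Z x)%:R)
      + psi (- s - Z 1 0) * (same_char_poly t s Z x && (pencil emb t s Z x == 0))%:R
         * q%:R ^+ conj_degree F x)).
    rewrite [RHS]exchange_big /=; apply: eq_bigr => s _.
    rewrite [RHS]exchange_big /=; apply: eq_bigr => Z _.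
    rewrite (cusp_value_companion emb cardK) mulrN mulr_sumr -sumrN big_mkcond [RHS]big_mkcond /=.
    apply: eq_bigr => x _; have [->|x0] /= := eqVneq x 0.
      by rewrite -/(same_char_poly t s Z 0) sq0.
    rewrite -/(same_char_poly t s Z x); case: (same_char_poly t s Z x) => /=.
      by ring.
    by rewrite !mulr0 mul0r oppr0 addr0 mulr0.
  apply: eq_bigr => x x0; rewrite -(sum_same_char_poly t0 x0).
  transitivity (theta x * (- (\sum_s \sum_(Z : 'M[F]_2)
        psi (- s - Z 1 0) * (same_char_poly t s Z x)%:R)
    + (\sum_s \sum_(Z : 'M[F]_2) psi (- s - Z 1 0)
     * (same_char_poly t s Z x && (pencil emb t s Z x == 0))%:R) * q%:R ^+ conj_degree F x)).
    rewrite mulr_suml -sumrN -big_split mulr_sumr /=; apply: eq_bigr => s _.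
    by rewrite mulr_suml -sumrN -big_split mulr_sumr.
  congr (_ * (_ + _)); rewrite sum_same_pencil //.
  case qc: (quadratic_conj t x); rewrite ?mul0r // !mul1r.
  by move/and3P: qc => [h1 h2 _]; rewrite /conj_degree (negPf h1) h2.
have qc0 : quadratic_conj t 0 = false.
  by rewrite /quadratic_conj expr0n gtn_eqF ?eqxx // ltnW // finNzRing_gt1.
have -> : \sum_(x | quadratic_conj t x) theta x
        = \sum_(x | x != 0) (quadratic_conj t x)%:R * theta x.
  rewrite big_mkcond [RHS]big_mkcond; apply: eq_bigr => x _.
  have [->|_] /= := eqVneq x 0; first by rewrite qc0.
  by case: ifP => _; rewrite ?mul1r ?mul0r.
rewrite big_mkcondr !mulr_sumr -big_split /=; apply: eq_bigr => x _.
by case: (_ == Nm x) => /=; ring.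
Qed.

End BesselSum.

(** * Square roots and norms *)

Section SquareRoots.

Lemma half_pred_gt0 n : odd n -> (1 < n)%N -> (0 < n.-1./2)%N.
Proof. by case: n => [|[|[|n]]]. Qed.

Lemma double_half_pred n : odd n -> n.-1 = (2 * n.-1./2)%N.
Proof. by case: n => //= n /even_halfK; rewrite mul2n. Qed.

Lemma pred_expn4 n : (0 < n)%N -> (n ^ 4).-1 = ((1 + n + n ^ 2 + n ^ 3) * n.-1)%N.
Proof.
case: n => // n _; rewrite -subn1 !expnS expn0; lia.
Qed.

Variable K : finFieldType.

(** Euler's criterion, from the cyclicity of the group of units. *)
Lemma square_criterion (x : K) : odd #|K| -> x ^+ (#|K|.-1)./2 = 1 -> exists y, y ^+ 2 = x.
Proof.
move=> oddK xh.
have K1 := finNzRing_gt1 K.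
have h_gt0 := half_pred_gt0 oddK K1.
have x0 : x != 0.
  by apply: contra_eq_neq xh => ->; rewrite expr0n gtn_eqF // eq_sym oner_eq0.
have /cyclicP[g gE] := field_unit_group_cyclic [set: {unit K}]%G.
have : finField_unit x0 \in <[g]>%g by rewrite -gE inE.
case/cycleP=> i xi.
have og : #[g]%g = #|K|.-1 by rewrite /order -gE card_finField_unit.
have : (g ^+ (i * (#|K|.-1)./2) == 1)%g.
  rewrite expgM -xi; apply/eqP/val_inj.
  by rewrite FinRing.val_unitX /= xh.
rewrite -order_dvdn og => dv.
have : (2 %| i)%N.
  by move: dv; rewrite {1}(double_half_pred oddK) dvdn_pmul2r.
case/dvdnP=> k ik; exists (val (g ^+ k)%g); rewrite -FinRing.val_unitX -expgM -ik -xi. by [].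
Qed.

End SquareRoots.

Section NormSquares.

Variables (F K : finFieldType) (emb : {rmorphism F -> K}).
Local Notation q := #|F|.
Hypothesis cardK : #|K| = (q ^ 4)%N.
Variables (Tr Nm : K -> F).
Hypothesis TrE : forall x, emb (Tr x) = \sum_(i < 4) x ^+ (q ^ i).
Hypothesis NmE : forall x, emb (Nm x) = \prod_(i < 4) x ^+ (q ^ i).

Lemma NmM x y : Nm (x * y) = Nm x * Nm y.
Proof.
apply: (fmorph_inj emb); rewrite rmorphM /= !NmE -big_split /=.
by apply: eq_bigr => i _; rewrite exprMn.
Qed.

Lemma Nm_eq0 x : (Nm x == 0) = (x == 0).
Proof.
rewrite -(fmorph_eq0 emb) NmE; apply/prodf_eq0/eqP => [[i _]|->].
  by rewrite expf_eq0 => /andP[_ /eqP].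
by exists ord0; rewrite // expn0 expr1.
Qed.

Lemma exp_emb a n : emb a ^+ (q ^ n) = emb a.
Proof. by elim: n => [|n IH]; rewrite ?expn0 ?expr1 // expnSr exprM IH -rmorphXn expf_card. Qed.

Lemma NmZ a x : Nm (emb a * x) = a ^+ 4 * Nm x.
Proof.
rewrite NmM; congr (_ * _); apply: (fmorph_inj emb); rewrite NmE rmorphXn /=.
by under eq_bigr do rewrite exp_emb; rewrite prodr_const card_ord.
Qed.

Lemma NmN x : Nm (- x) = Nm x.
Proof.
have -> : - x = emb (-1) * x by rewrite rmorphN rmorph1 mulN1r.
by rewrite NmZ -signr_odd expr0 mul1r.
Qed.

Lemma TrZ a x : Tr (emb a * x) = a * Tr x.
Proof.
apply: (fmorph_inj emb); rewrite rmorphM /= !TrE mulr_sumr.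
by apply: eq_bigr => i _; rewrite exprMn exp_emb.
Qed.

(** In even characteristic everything is a square.  Otherwise the exponent
[(q^4 - 1) / 2] of Euler's criterion is the exponent of the norm times [(q - 1) / 2]. *)
Lemma norm_square_root (z : K) (s : F) : z != 0 -> s ^+ 2 = Nm z -> exists y, y ^+ 2 = z.
Proof.
move=> z0 sN; case odd_q: (odd q); last first.
  (* raising to half of the even number q^4 extracts square roots *)
  exists (z ^+ (q ^ 4)./2); rewrite -exprM muln2 halfK.
  by rewrite oddX odd_q /= subn0 -cardK expf_card.
apply: square_criterion; first by rewrite cardK oddX odd_q orbT.
have s0 : s != 0.
  by apply: contraNneq z0 => s0; rewrite -Nm_eq0 -sN s0 expr0n.
have embN : emb (Nm z) = z ^+ (1 + q + q ^ 2 + q ^ 3).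
  rewrite NmE !big_ord_recl big_ord0 /= /bump /= mulr1 expn0 expn1 !exprD expr1.
  by ring.
have hE : (#|K|.-1)./2 = ((1 + q + q ^ 2 + q ^ 3) * q.-1./2)%N.
  have q0 : (0 < q)%N by rewrite ltnW // finNzRing_gt1.
  rewrite cardK; rewrite pred_expn4 // {1}(double_half_pred odd_q).
  by rewrite mulnCA mul2n doubleK.
rewrite hE exprM -embN -sN -rmorphXn -exprM /=.
rewrite -double_half_pred //.
have -> : s ^+ q.-1 = 1; last by rewrite rmorph1.
apply: (mulfI s0); rewrite -exprS prednK ?expf_card ?mulr1 //.
by rewrite ltnW // finNzRing_gt1.
Qed.

Variable C : numClosedFieldType.

(** If [s^2 = N z], the square roots of [z] have a common norm, [s] or [- s].  In odd
characteristic there are two roots and one sign fits; in characteristic 2 there is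
one root and both signs fit. *)
Lemma count_square_roots (z : K) (s : F) : z != 0 -> s != 0 ->
  \sum_(y | (y != 0) && (y ^+ 2 == z)) ((s == Nm y)%:R + (s == - Nm y)%:R)
  = 2 * (s ^+ 2 == Nm z)%:R :> C.
Proof.
move=> z0 s0; case: eqP => [sN|sN]; last first.
  rewrite mulr0 big1 // => y /andP[_ /eqP yz].
  case: eqP => [sy|_]; first by case: sN; rewrite sy expr2 -NmM -expr2 yz.
  case: eqP => [sy|_]; last by rewrite addr0.
  by case: sN; rewrite sy sqrrN expr2 -NmM -expr2 yz.
have [y0 y0z] := norm_square_root z0 sN.
have y00 : y0 != 0 by move: z0; rewrite -y0z expf_eq0.
have eqS : s ^+ 2 = Nm y0 ^+ 2 by rewrite sN -y0z !expr2 NmM.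
have PE y : (y != 0) && (y ^+ 2 == z) = (y == y0) || (y == - y0).
  rewrite -y0z eqf_sqr andb_idl // => /orP[]/eqP-> //.
  by rewrite oppr_eq0.
have [two0|two0] := eqVneq (2 : F) 0.
  have oppF (a : F) : - a = a.
    by apply/eqP; rewrite -subr_eq0 -opprD oppr_eq0 -mulr2n -mulr_natr two0 mulr0.
  have oppK (a : K) : - a = a.
    apply/eqP; rewrite -subr_eq0 -opprD oppr_eq0 -mulr2n -mulr_natr.
    by rewrite -(rmorph_nat emb) two0 rmorph0 mulr0.
  rewrite (big_pred1 y0) => [|y]; last by rewrite PE oppK orbb.
  have -> : s = Nm y0 by move/eqP: eqS; rewrite eqf_sqr oppF orbb => /eqP.
  by rewrite oppF eqxx mulr1.
have neF (a : F) : a != 0 -> a != - a.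
  by move=> a0; rewrite -addr_eq0 -mulr2n -mulr_natr mulf_neq0.
have neK : - y0 != y0.
  rewrite eq_sym -addr_eq0 -mulr2n -mulr_natr mulf_neq0 //.
  by rewrite -(rmorph_nat emb) fmorph_eq0.
rewrite (bigD1 y0) /=; last by rewrite PE eqxx.
rewrite (big_pred1 (- y0)) => [|y]; last first.
  by rewrite /= PE; case: (eqVneq y y0) => [->|_] /=; rewrite ?andbT // eq_sym (negPf neK).
rewrite NmN mulr1.
have n0 : Nm y0 != 0 by rewrite Nm_eq0.
have /orP[/eqP->|/eqP->] : (s == Nm y0) || (s == - Nm y0) by rewrite -eqf_sqr eqS.
  by rewrite eqxx (negPf (neF _ n0)) addr0.
by rewrite eqxx eq_sym (negPf (neF _ n0)) add0r.
Qed.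

Lemma sum_over_squares (g : K -> F -> C) :
  \sum_(y | y != 0) (g (y ^+ 2) (Nm y) + g (y ^+ 2) (- Nm y))
  = 2 * \sum_(z | z != 0) \sum_(s | (s != 0) && (s ^+ 2 == Nm z)) g z s.
Proof.
transitivity (\sum_(z | z != 0) \sum_(s | s != 0) g z s *
  \sum_(y | (y != 0) && (y ^+ 2 == z)) ((s == Nm y)%:R + (s == - Nm y)%:R)); last first.
  rewrite mulr_sumr; apply: eq_bigr => z z0; rewrite mulr_sumr big_mkcondr.
  apply: eq_bigr => s s0; rewrite count_square_roots //.
  by case: eqP => _ /=; ring.
transitivity (\sum_(y : K | y != 0) \sum_(z | z != 0) \sum_(s | s != 0)
   (if z == y ^+ 2 then g z s * ((s == Nm y)%:R + (s == - Nm y)%:R) else 0)).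
  apply: eq_bigr => y y0; symmetry.
  rewrite (bigD1 (y ^+ 2)) ?expf_neq0 //= [X in _ + X = _]big1 ?addr0; last first.
    by move=> z /andP[_ /negPf zy]; rewrite big1 // => s _; rewrite zy.
  rewrite eqxx; under eq_bigr do rewrite mulrDr.
  rewrite big_split /=; congr (_ + _).
    rewrite (bigD1 (Nm y)) ?Nm_eq0 //= eqxx mulr1 big1 ?addr0 // => s /andP[_ /negPf->].
    by rewrite mulr0.
  rewrite (bigD1 (- Nm y)) ?oppr_eq0 ?Nm_eq0 //= eqxx mulr1 big1 ?addr0 // => s /andP[_ /negPf->].
  by rewrite mulr0.
rewrite exchange_big /=; apply: eq_bigr => z _.
rewrite exchange_big /=; apply: eq_bigr => s _.
rewrite mulr_sumr big_mkcondr; apply: eq_bigr => y _.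
by rewrite eq_sym; case: ifP.
Qed.

End NormSquares.

(** * Evaluation of the final sum *)

Section GammaIdentity.

Variables (F K : finFieldType) (emb : {rmorphism F -> K}).
Local Notation q := #|F|.
Hypothesis cardK : #|K| = (q ^ 4)%N.
Variables (Tr Nm : K -> F).
Hypothesis TrE : forall x, emb (Tr x) = \sum_(i < 4) x ^+ (q ^ i).
Hypothesis NmE : forall x, emb (Nm x) = \prod_(i < 4) x ^+ (q ^ i).
Variables (C : numClosedFieldType) (theta : K -> C).
Hypothesis theta_char : multiplicative_char theta.
Variables (psi : F -> C) (psi_char : additive_char psi).
Hypothesis psi_nontriv : exists x, psi x != 1.

Lemma theta_neq0 x : x != 0 -> theta x != 0.
Proof.
move=> x0; apply/eqP => t0; have := theta_char.2 x x^-1 x0.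
rewrite invr_eq0 => /(_ x0); rewrite mulfV // theta_char.1 t0 mul0r => /eqP.
by rewrite oner_eq0.
Qed.

Lemma thetaM x y : x != 0 -> y != 0 -> theta (x * y) = theta x * theta y.
Proof. exact: theta_char.2. Qed.

(** Moving the variable by [f] shows that the sum is [c] times itself. *)
Lemma sum_twisted_eq0 (T : finType) (f : T -> T) (P : pred T) (g : T -> C) (c : C) :
  injective f -> (forall x, P (f x) = P x) -> (forall x, P x -> g (f x) = c * g x) ->
  c != 1 -> \sum_(x | P x) g x = 0.
Proof.
move=> f_inj fP fg c1; apply/eqP; have : (1 - c) * \sum_(x | P x) g x == 0.
  rewrite mulrBl mul1r subr_eq0 mulr_sumr (reindex_inj f_inj) /=.
  by apply/eqP; apply: eq_big => [x|x /[!fP] /fg].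
by rewrite mulf_eq0 subr_eq0 eq_sym (negPf c1).
Qed.

Definition gauss_emb : C := \sum_(a : F | a != 0) theta (emb a^-1) * psi a.

Lemma emb_neq0 a : a != 0 -> emb a != 0. Proof. by rewrite fmorph_eq0. Qed.

(** For fixed [t = b / c], the variable of the Gauss sum is [(t c)^-1]. *)
Lemma sum_gauss (B : F -> C) :
  \sum_(b : F | b != 0) \sum_(c : F | c != 0) psi b^-1 * (theta (emb c) * B (b / c))
  = gauss_emb * \sum_(t | t != 0) (theta (emb t))^-1 * B t.
Proof.
rewrite exchange_big /= mulr_sumr.
transitivity (\sum_(c | c != 0) \sum_(t | t != 0) psi (t * c)^-1 * (theta (emb c) * B t)).
  apply: eq_bigr => c c0; rewrite (reindex_inj (mulIf c0)) /=.
  by apply: eq_big => [t|t _]; rewrite ?mulf_eq0 ?(negPf c0) ?orbF // mulfK.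
rewrite exchange_big /=; apply: eq_bigr => t t0.
have f_inj : injective (fun c : F => (t * c)^-1).
  by move=> c c' /invr_inj/(mulfI t0).
rewrite /gauss_emb mulr_suml [RHS](reindex_inj f_inj) /=.
apply: eq_big => [c|c c0]; first by rewrite invr_eq0 mulf_eq0 (negPf t0).
rewrite invrK rmorphM thetaM ?emb_neq0 //; field.
by rewrite theta_neq0 ?emb_neq0.
Qed.

(** The substitution is [x = t z] with [t = s^-1], so that the condition becomes
[s^2 = N z]. *)
Lemma sum_norm_square :
  \sum_(t | t != 0) (theta (emb t))^-1 *
     \sum_(x | (x != 0) && (t ^+ 2 == Nm x)) theta x * kloosterman psi 1 (Tr x + t * Tr x^-1)
  = 2^-1 * \sum_(y | y != 0)
      (theta (y ^+ 2) * kloosterman psi 1 (Tr (y ^+ 2)^-1 + Tr (y ^+ 2) / Nm y)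
       + theta (y ^+ 2) * kloosterman psi 1 (Tr (y ^+ 2)^-1 - Tr (y ^+ 2) / Nm y)).
Proof.
have := sum_over_squares cardK NmE
  (fun z s => theta z * kloosterman psi 1 (Tr z^-1 + Tr z / s)).
under eq_bigr do rewrite invrN mulrN.
move=> ->; rewrite mulKf ?pnatr_eq0 //.
rewrite (reindex_inj invr_inj) /= [RHS](exchange_big_dep (fun s : F => s != 0)) /=; last first.
  by move=> z s _ /andP[].
apply: eq_big => [s|s]; rewrite invr_eq0 // => s0.
have es0 := emb_neq0 s0; rewrite mulr_sumr.
rewrite (reindex_inj (mulfI (invr_neq0 es0))) /=.
apply: eq_big => [z|z /andP[z0 _]].
  rewrite mulf_eq0 invr_eq0 (negPf es0) s0 /=; congr (_ && _).
  rewrite -fmorphV (NmZ NmE) -(inj_eq (mulfI (expf_neq0 4 s0))) !exprVn.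
  by rewrite mulVKf ?expf_neq0 // (exprD s 2 2) mulfK ?expf_neq0.
have z1 : z != 0 by apply: contraNneq z0 => ->; rewrite mulr0.
rewrite fmorphV thetaM ?invr_eq0 // !mulrA mulVf ?theta_neq0 ?invr_eq0 // mul1r.
by rewrite invfM invrK -fmorphV !(TrZ TrE) mulKf // addrC [s^-1 * _]mulrC.
Qed.

Lemma exp_emb_card (a : F) : emb a ^+ q = emb a.
Proof. exact: frob_emb. Qed.

(** Each [x] of degree 2 is counted for the single [t = - x x^q], where
[theta x / theta t = theta (- x^q)^-1], and [x |-> - x^q] permutes the elements of
degree 2. *)
Lemma sum_quadratic_conj (h : K) : h != 0 -> h ^+ (q ^ 2) = h -> theta h != 1 ->
  \sum_(t | t != 0) (theta (emb t))^-1 * \sum_(x | quadratic_conj emb t x) theta x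
  = - \sum_(a : F | a != 0) (theta (emb a))^-1.
Proof.
move=> h0 h2 th1.
have expq0 (x : K) : (x ^+ q == 0) = (x == 0).
  by rewrite expf_eq0 (ltnW (finNzRing_gt1 F)).
pose P2 (x : K) := (x != 0) && (x ^+ (q ^ 2) == x).
have sum2 : \sum_(x | P2 x) (theta x)^-1 = 0.
  apply: (sum_twisted_eq0 (f := fun x => h * x) (c := (theta h)^-1)).
  - exact: mulfI.
  - move=> x; rewrite /P2 mulf_eq0 (negPf h0) exprMn h2; congr (_ && _).
    exact: (inj_eq (mulfI h0)).
  - by move=> x /andP[x0 _]; rewrite thetaM // invfM.
  - by rewrite invr_eq1.
have sub : \sum_(x | P2 x && (x ^+ q == x)) (theta x)^-1
         = \sum_(a : F | a != 0) (theta (emb a))^-1.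
  transitivity (\sum_(x in [set emb a | a in [set a : F | a != 0]]) (theta x)^-1).
    apply: eq_bigl => x; apply/andP/imsetP => [[/andP[x0 _] /eqP xq]|[a]].
      have [a xa] := @frob_fixed _ _ emb x xq.
      by exists a => //; rewrite inE -(fmorph_eq0 emb) -xa.
    by rewrite inE => a0 ->; rewrite /P2 emb_neq0 // !(exp_emb emb a 2) exp_emb_card eqxx.
  rewrite big_imset /=; last by move=> a b _ _; apply: fmorph_inj.
  by apply: eq_bigl => a; rewrite inE.
have ns : \sum_(x | P2 x && (x ^+ q != x)) (theta x)^-1
        = - \sum_(a : F | a != 0) (theta (emb a))^-1.
  apply/eqP; rewrite -addr_eq0 -sub addrC.
  by have /eqP := sum2; rewrite (bigID (fun x => x ^+ q == x)).
rewrite -ns; have frobI : injective (fun x : K => x ^+ q) := @frob_inj F K emb.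
have E1 : theta 1 = 1 := theta_char.1.
transitivity (\sum_(x | P2 x && (x ^+ q != x)) (theta (- x ^+ q))^-1); last first.
  rewrite [RHS](reindex_inj (h := fun x => - x ^+ q)) /=; last first.
    by move=> x y /oppr_inj; apply: (@frob_inj F K emb x y).
  apply: eq_bigl => x; rewrite /P2 oppr_eq0 expq0.
  have opp n : (- x ^+ q) ^+ (q ^ n) = - (x ^+ (q ^ n)) ^+ q.
    have -> : - x ^+ q = emb (-1) * x ^+ q by rewrite rmorphN rmorph1 mulN1r.
    by rewrite exprMn exp_emb rmorphN rmorph1 mulN1r exprAC.
  have := opp 1; have := opp 2; rewrite !expn1 => -> ->.
  by rewrite !(inj_eq oppr_inj) !(inj_eq frobI).
transitivity (\sum_(t : F | t != 0) \sum_(x | P2 x && (x ^+ q != x))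
   (if x * x ^+ q == - emb t then (theta (- x ^+ q))^-1 else 0)).
  apply: eq_bigr => t t0; rewrite mulr_sumr big_mkcond [RHS]big_mkcond /=.
  apply: eq_bigr => x _; rewrite /quadratic_conj /P2.
  have [x0|x0] := eqVneq x 0.
    rewrite x0 expr0n gtn_eqF ?eqxx //=; exact: ltnW (finNzRing_gt1 F).
  case: eqP => [//|_] /=; first by rewrite andbF.
  case: eqP => //= x2; case: eqP => // xt.
  have -> : emb t = x * - x ^+ q by rewrite mulrN xt opprK.
  by rewrite thetaM ?oppr_eq0 ?expq0 // invfM mulrAC mulVf ?theta_neq0 ?mul1r.
rewrite exchange_big /=; apply: eq_bigr => x /andP[/andP[x0 /eqP x2] xq].
have [t tE] : exists t, - (x * x ^+ q) = emb t.
  apply: frob_fixed; rewrite rmorphN rmorphM /= /frob -exprM mulnn x2.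
  by rewrite mulrC.
have t0 : t != 0 by rewrite -(fmorph_eq0 emb) -tE oppr_eq0 mulf_neq0 // expq0.
rewrite (bigD1 t) //= -tE opprK eqxx big1 ?addr0 // => u /andP[_ ut].
case: eqP => // xu; case/eqP: ut; apply: (fmorph_inj emb).
by rewrite -tE xu opprK.
Qed.

Lemma sum_theta_emb a0 : a0 != 0 -> theta (emb a0) != 1 ->
  \sum_(a : F | a != 0) theta (emb a) = 0 /\ \sum_(a : F | a != 0) (theta (emb a))^-1 = 0.
Proof.
move=> a00 th1; split.
  apply: (sum_twisted_eq0 (f := fun x => a0 * x) (c := theta (emb a0))) => //.
  - exact: mulfI.
  - by move=> a; rewrite mulf_eq0 (negPf a00).
  - by move=> a a_n0; rewrite rmorphM thetaM ?emb_neq0.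
apply: (sum_twisted_eq0 (f := fun x => a0 * x) (c := (theta (emb a0))^-1)).
- exact: mulfI.
- by move=> a; rewrite mulf_eq0 (negPf a00).
- by move=> a a_n0; rewrite rmorphM thetaM ?emb_neq0 // invfM.
- by rewrite invr_eq1.
Qed.

(** The Bessel function at the antidiagonal block matrix [0 t; 1 0], by
[bessel_anti_mx1]. *)
Definition bessel_value (t : F) : C :=
  q%:R ^- 5 * (- q%:R * (\sum_(x | (x != 0) && (t ^+ 2 == Nm x))
                theta x * kloosterman psi 1 (Tr x + t * Tr x^-1))
    + q%:R ^+ 2 * \sum_(x | quadratic_conj emb t x) theta x).

(** When [theta] is trivial on [F] the Gauss sum is [-1], and the scalar matrices
and [sum_quadratic_conj] contribute [(q - 1) / q + (q - 1) / q^2 = (q^2 - 1) / q^2].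
When it is not, both contributions vanish. *)
Lemma gamma_identity (h : K) : h != 0 -> h ^+ (q ^ 2) = h -> theta h != 1 ->
  q%:R^-1 * (\sum_(a : F | a != 0) theta (emb a))
  + q%:R * \sum_(b : F | b != 0) \sum_(c : F | c != 0)
        psi b^-1 * (theta (emb c) * bessel_value (b / c))
  = q%:R ^- 2 * (if [forall a : F, (a != 0) ==> (theta (emb a) == 1)] then q%:R ^+ 2 - 1 else 0)
    - 2^-1 * q%:R ^- 3 * gauss_emb *
      (\sum_(y | y != 0)
        theta (y ^+ 2) * kloosterman psi 1 (Tr (1 / y ^+ 2) + Tr (y ^+ 2) / Nm y))
    - 2^-1 * q%:R ^- 3 * gauss_emb *
      (\sum_(y | y != 0)
        theta (y ^+ 2) * kloosterman psi 1 (Tr (1 / y ^+ 2) - Tr (y ^+ 2) / Nm y)).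
Proof.
move=> h0 h2 th1; rewrite sum_gauss.
have q0 : q%:R != 0 :> C by rewrite pnatr_eq0 -lt0n ltnW // finNzRing_gt1.
have -> : \sum_(t | t != 0) (theta (emb t))^-1 * bessel_value t
  = q%:R ^- 5 * (- q%:R * (\sum_(t | t != 0) (theta (emb t))^-1 *
       \sum_(x | (x != 0) && (t ^+ 2 == Nm x)) theta x * kloosterman psi 1 (Tr x + t * Tr x^-1))
    + q%:R ^+ 2 * (\sum_(t | t != 0) (theta (emb t))^-1 *
       \sum_(x | quadratic_conj emb t x) theta x)).
  rewrite !mulr_sumr -big_split /= mulr_sumr; apply: eq_bigr => t _.
  by rewrite /bessel_value; ring.
rewrite sum_norm_square (sum_quadratic_conj h0 h2 th1) big_split /=.
under [\sum_(y | y != 0) theta (y ^+ 2) * kloosterman psi 1 (Tr (1 / _) + _)]eq_bigr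
  do rewrite div1r.
under [\sum_(y | y != 0) theta (y ^+ 2) * kloosterman psi 1 (Tr (1 / _) - _)]eq_bigr
  do rewrite div1r.
set M2 := \sum_(i | _) (_ * kloosterman _ _ (_ - _)).
set M1 := \sum_(i | _) (_ * kloosterman _ _ (_ + _)).
have two0 : 2 != 0 :> C by rewrite pnatr_eq0.
case: ifP => [/forallP triv|/negbT/forallPn[a0]]; last first.
  rewrite negb_imply => /andP[a00 tha0]; have [-> ->] := sum_theta_emb a00 tha0.
  by field; rewrite q0.
have tr a : a != 0 -> theta (emb a) = 1 by move=> a0; have /implyP/(_ a0)/eqP := triv a.
have cardF : \sum_(a : F | a != 0) (1 : C) = q%:R - 1.
  rewrite sumr_const (cardC1 (0 : F)) -subn1 natrB //.
  by rewrite ltnW // finNzRing_gt1.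
have -> : \sum_(a : F | a != 0) theta (emb a) = q%:R - 1.
  by rewrite -cardF; apply: eq_bigr => a /tr.
have -> : \sum_(a : F | a != 0) (theta (emb a))^-1 = q%:R - 1.
  by rewrite -cardF; apply: eq_bigr => a /tr ->; rewrite invr1.
have -> : gauss_emb = -1.
  have := sum_character_eq0 (psiD psi_char) psi_nontriv; rewrite (bigD1 0) //= (psi0 psi_char).
  move/eqP; rewrite addrC addr_eq0 => /eqP <-; apply: eq_bigr => a a0.
  by rewrite tr ?mul1r // invr_eq0.
by field; rewrite q0.
Qed.

End GammaIdentity.

(** * Cosets and unipotent matrices *)

Section CosetSums.

Variables (gT : finGroupType) (C : numFieldType).

(** A sum over representatives is an average over the group, which makes it
independent of their choice and lets the group variables be substituted freely. *)
Lemma sum_rcosets (N G : {group gT}) (f : gT -> C) : N \subset G ->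
  (forall n g, n \in N -> g \in G -> f (n * g)%g = f g) ->
  \sum_(A in rcosets N G) f (repr A) = #|N|%:R^-1 * \sum_(g in G) f g.
Proof.
move=> sNG fN; rewrite (set_partition_big _ (rcosets_partition sNG)) mulr_sumr /=.
apply: eq_bigr => A /rcosetsP[x Gx ->].
rewrite (eq_bigr (fun=> f (repr (N :* x)%g))) => [|g].
  rewrite sumr_const card_rcoset -[f _ *+ _]mulr_natl mulKf //.
  by rewrite pnatr_eq0 -lt0n cardG_gt0.
by case/rcosetP=> m Nm ->; case: (repr_rcosetP N x) => n Nn; rewrite !fN.
Qed.

Lemma card_coset_factor (N G : {group gT}) : N \subset G ->
  #|G : N|%g%:R * #|N|%:R = #|G|%:R :> C.
Proof. by move=> sNG; rewrite -natrM mulnC Lagrange. Qed.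

End CosetSums.

Section Upper4.

Variable F : finFieldType.
Local Notation q := #|F|.

Definition up_mx (x y : F) (Z : 'M[F]_2) : 'M[F]_(2 + 2) :=
  block_mx (mx2 1 x 0 1) Z 0 (mx2 1 y 0 1).

Lemma upM x y Z x' y' Z' : up_mx x y Z *m up_mx x' y' Z'
  = up_mx (x + x') (y + y') (mx2 1 x 0 1 *m Z' + Z *m mx2 1 y' 0 1).
Proof.
rewrite mulmx_block !mulmx0 !mul0mx !addr0 !add0r !mx2M.
by rewrite !mulr0 !mul0r !mul1r !mulr1 !addr0 !add0r [x' + x]addrC [y' + y]addrC.
Qed.

Lemma det_up x y Z : \det (up_mx x y Z) = 1.
Proof. by rewrite det_ublock !det_mx2; ring. Qed.

Lemma up_mx_unit x y Z : up_mx x y Z \in unitmx.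
Proof. by rewrite unitmxE det_up unitr1. Qed.

Lemma char_poly_up x y Z : char_poly (up_mx x y Z) = ('X - 1%:P) ^+ 4.
Proof.
rewrite /char_poly /char_poly_mx map_block_mx scalar_mx_block opp_block_mx add_block_mx.
rewrite map_mx0 subr0 det_ublock !mx2E !det_mx2 !rmorph0 !rmorph1.
by ring.
Qed.

Lemma toGL_mul (A B : 'M[F]_(2 + 2)) : A \in unitmx -> B \in unitmx ->
  @toGL F 4 (A *m B) = (@toGL F 4 A * @toGL F 4 B)%g.
Proof.
move=> uA uB; apply: val_inj; rewrite -[LHS]/(GLval _) -[RHS]/(GLval _) GL_MxE.
by rewrite !toGLK // unitmx_mul uA uB.
Qed.

Lemma toGL_val n (u : {'GL_n[F]}) : toGL (GLval u) = u.
Proof. by apply: val_inj; rewrite /= toGLK // GL_unitmx. Qed.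

Definition upG x y Z : {'GL_4[F]} := @toGL F 4 (up_mx x y Z).

Lemma upGE x y Z : GLval (upG x y Z) = up_mx x y Z.
Proof. by rewrite toGLK // up_mx_unit. Qed.

Lemma upG_inj x y Z x' y' Z' : upG x y Z = upG x' y' Z' -> [/\ x = x', y = y' & Z = Z'].
Proof.
move/(congr1 GLval); rewrite !upGE => E.
have [h1 h2 _ h4] := @eq_block_mx F 2 2 2 2 _ _ _ _ _ _ _ _ E.
by have [_ hx _ _] := mx2_inj h1; have [_ hy _ _] := mx2_inj h4.
Qed.

Lemma unip4P (u : {'GL_4[F]}) :
  reflect (exists x y Z, u = upG x y Z) (u \in unip_upper F 4).
Proof.
rewrite inE; apply: (iffP forallP) => [H|[x [y [Z ->]]] i].
  pose A : 'M[F]_(2 + 2) := GLval u.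
  have HA (i j : 'I_(2 + 2)) : (j <= i)%N -> A i j = (i == j)%:R.
    by move=> le; have /forallP/(_ j)/implyP/(_ le)/eqP := H i.
  exists (ulsubmx A 0 1), (drsubmx A 0 1), (ursubmx A).
  rewrite -[LHS]toGL_val; congr (toGL _).
  have e1 : ulsubmx A = mx2 1 (ulsubmx A 0 1) 0 1.
    by rewrite [LHS]mx2_eta; congr (mx2 _ _ _ _); rewrite !mxE HA.
  have e2 : dlsubmx A = 0.
    by apply/matrixP=> i j; rewrite !mxE HA ?eq_rlshift //= ltnW // ltn_addr.
  have e3 : drsubmx A = mx2 1 (drsubmx A 0 1) 0 1.
    by rewrite [LHS]mx2_eta; congr (mx2 _ _ _ _); rewrite !mxE HA.
  by rewrite /up_mx -e1 -e2 -e3 submxK.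
apply/forallP => j; rewrite upGE; apply/implyP => le; apply/eqP.
move: i j le; change (forall i j : 'I_(2 + 2), (j <= i)%N -> up_mx x y Z i j = (i == j)%:R).
move=> i j; case: (split_ordP i) => i0 ->; case: (split_ordP j) => j0 -> /=.
- rewrite block_mxEul mxE; case: i0 => [[|[|//]] ?]; case: j0 => [[|[|//]] ?] //.
- by rewrite leqNgt ltn_addr.
- by rewrite block_mxEdl mxE eq_rlshift.
- rewrite block_mxEdr mxE; case: i0 => [[|[|//]] ?]; case: j0 => [[|[|//]] ?] //.
Qed.

Lemma sum_unip4 (C : nmodType) (f : {'GL_4[F]} -> C) :
  \sum_(u in unip_upper F 4) f u = \sum_x \sum_y \sum_Z f (upG x y Z).
Proof.
rewrite pair_bigA pair_bigA /=.
have E : unip_upper F 4 = [set upG p.1.1 p.1.2 p.2 | p : F * F * 'M[F]_2].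
  apply/setP=> u; apply/unip4P/imsetP => [[x [y [Z ->]]]|[[[x y] Z] _ ->]].
    by exists (x, y, Z).
  by exists x, y, Z.
rewrite E big_imset //=; last first.
  by move=> [[x y] Z] [[x' y'] Z'] _ _ /= /upG_inj[-> -> ->].
Qed.

Lemma card_unip4 : #|unip_upper F 4| = (q ^ 6)%N.
Proof.
rewrite -sum1_card sum_unip4 !sum_nat_const muln1 card_mx.
by rewrite -!expnS.
Qed.

Lemma superdiag_block2 (A Z B D : 'M[F]_2) :
  superdiag (block_mx A Z B D) = A 0 1 + Z 1 0 + D 0 1.
Proof.
rewrite /superdiag; under eq_bigr do rewrite big_mkcond big_split_ord /=.
rewrite big_split_ord !big_ord_recl !big_ord0 /= !(addr0, add0r).
rewrite block_mxEul block_mxEur block_mxEdr.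
rewrite (mx2_eta A) (mx2_eta Z) (mx2_eta D) !mxE /=. by [].
Qed.

Variables (C : numClosedFieldType) (psi : F -> C) (psi_char : additive_char psi).

Lemma psi_unip_up x y Z : psi_unip psi (upG x y Z) = psi (x + y + Z 1 0).
Proof.
rewrite /psi_unip -[X in psi X]/(superdiag (GLval (upG x y Z))) upGE.
by rewrite superdiag_block2 !mxE /= addrAC.
Qed.

Lemma upG_mul x y Z x' y' Z' : (upG x y Z * upG x' y' Z')%g
  = upG (x + x') (y + y') (mx2 1 x 0 1 *m Z' + Z *m mx2 1 y' 0 1).
Proof. by rewrite -toGL_mul ?up_mx_unit // upM. Qed.

Lemma unip4_group : group_set (unip_upper F 4).
Proof.
apply/group_setP; split=> [|u v /unip4P[x [y [Z ->]]] /unip4P[x' [y' [Z' ->]]]].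
  apply/unip4P; exists 0, 0, 0; apply: val_inj; rewrite /= upGE /up_mx -mx2_scalar.
  by rewrite -scalar_mx_block.
by rewrite upG_mul; apply/unip4P; do 3?eexists.
Qed.

Lemma psi_unipM u v : u \in unip_upper F 4 -> v \in unip_upper F 4 ->
  psi_unip psi (u * v)%g = psi_unip psi u * psi_unip psi v.
Proof.
move=> /unip4P[x [y [Z ->]]] /unip4P[x' [y' [Z' ->]]]; rewrite upG_mul !psi_unip_up.
rewrite -(psiD psi_char) (mx2_eta Z) (mx2_eta Z') !mx2E !mxE /=; congr psi.
by ring.
Qed.

End Upper4.

(** * The Bessel function *)

Section BesselFunction.

Variables (F : finFieldType) (C : numClosedFieldType).
Local Notation q := #|F|.
Variables (psi : F -> C) (psi_char : additive_char psi).
Hypothesis psi_nontriv : exists x, psi x != 1.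
Variables (d : nat) (pi : mx_representation C 'GL_4[F] d).
Local Notation N := (unip_upper F 4).

Lemma psi_unip_neq0 (u : {'GL_4[F]}) : psi_unip psi u != 0.
Proof. exact: psi_neq0. Qed.

(** The trace of the compression of [pi g] to the image of the projection
[whittaker_proj], by [bessel_trace]. *)
Definition bessel (g : {'GL_4[F]}) : C :=
  #|N|%:R^-1 * \sum_(u in N) (psi_unip psi u)^-1 * \tr (pi (g * u)%g).

Lemma piM g h : pi (g * h)%g = pi g *m pi h.
Proof. by rewrite repr_mxM ?inE. Qed.

Lemma trace_piC g h : \tr (pi (g * h)%g) = \tr (pi (h * g)%g).
Proof. by rewrite !piM mxtrace_mulC. Qed.

Let NG : {group {'GL_4[F]}} := Group (unip4_group F).

Lemma bessel_mul_left u g : u \in N -> bessel (u * g)%g = psi_unip psi u * bessel g.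
Proof.
move=> Nu; rewrite /bessel mulrCA; congr (_ * _).
rewrite mulr_sumr [RHS](reindex_inj (mulIg u)) /=.
apply: eq_big => [v|v Nv]; first exact/esym/(groupMr v (Nu : u \in NG)).
have -> : \tr (pi (u * g * v)%g) = \tr (pi (g * (v * u))%g).
  by rewrite -(mulgA u) trace_piC mulgA.
by rewrite psi_unipM //; field; rewrite !psi_unip_neq0.
Qed.

Lemma bessel_mul_right u g : u \in N -> bessel (g * u)%g = psi_unip psi u * bessel g.
Proof.
move=> Nu; rewrite /bessel mulrCA; congr (_ * _).
rewrite mulr_sumr [RHS](reindex_inj (mulgI u)) /=.
apply: eq_big => [v|v Nv]; first exact/esym/(groupMl v (Nu : u \in NG)).
by rewrite psi_unipM // -mulgA; field; rewrite !psi_unip_neq0.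
Qed.

(** Each nonzero row is a Whittaker functional. *)
Definition whittaker_proj : 'M[C]_d :=
  #|N|%:R^-1 *: \sum_(u in N) (psi_unip psi u)^-1 *: pi u.

Lemma whittaker_projM u : u \in N -> whittaker_proj *m pi u = psi_unip psi u *: whittaker_proj.
Proof.
move=> Nu; rewrite /whittaker_proj -scalemxAl scalerA mulrC -scalerA; congr (_ *: _).
rewrite mulmx_suml scaler_sumr [RHS](reindex_inj (mulIg u)) /=.
apply: eq_big => [v|v Nv]; first exact/esym/(groupMr v (Nu : u \in NG)).
rewrite psi_unipM // -scalemxAl piM scalerA; congr (_ *: _).
by field; rewrite !psi_unip_neq0.
Qed.

Lemma bessel_trace g : bessel g = \tr (whittaker_proj *m pi g).
Proof.
rewrite mxtrace_mulC /whittaker_proj -scalemxAr mxtraceZ mulmx_sumr raddf_sum.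
congr (_ * _); apply: eq_bigr => u _.
by rewrite /= -scalemxAr mxtraceZ piM.
Qed.

Definition coordinate_whittaker (s : {'GL_4[F]}) (i : 'I_d) (g : {'GL_4[F]}) : C :=
  (row i whittaker_proj *m pi g *m (pi s *m col i 1%:M)) 0 0.

(** This exhibits the Bessel function as a sum of functions of the Whittaker model, for
which the functional equation holds by hypothesis. *)
Lemma sum_coordinate_whittaker s g :
  \sum_i coordinate_whittaker s i g = bessel (g * s)%g.
Proof.
rewrite bessel_trace /mxtrace piM; apply: eq_bigr => i _.
rewrite /coordinate_whittaker mulmxA -!row_mul (colE i 1%:M) mul1mx -colE mxE mxE mulmxA. by [].
Qed.

End BesselFunction.

(** * Values of the Bessel function *)

Section BesselValues.

Variables (F K : finFieldType) (emb : {rmorphism F -> K}).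
Local Notation q := #|F|.
Hypothesis cardK : #|K| = (q ^ 4)%N.
Variables (Tr Nm : K -> F).
Hypothesis TrE : forall x, emb (Tr x) = \sum_(i < 4) x ^+ (q ^ i).
Hypothesis NmE : forall x, emb (Nm x) = \prod_(i < 4) x ^+ (q ^ i).
Variables (C : numClosedFieldType) (theta : K -> C).
Hypothesis theta_char : multiplicative_char theta.
Variables (psi : F -> C) (psi_char : additive_char psi).
Hypothesis psi_nontriv : exists x, psi x != 1.
Variables (d : nat) (pi : mx_representation C 'GL_4[F] d).
Hypothesis trace_pi : forall g, \tr (pi g) = cusp_value emb theta (GLval g).

Lemma card_neq0 : q%:R != 0 :> C.
Proof. by rewrite pnatr_eq0 -lt0n ltnW // finNzRing_gt1. Qed.

(** The only element of [K] that is conjugate to [a] is [a] itself. *)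
Lemma trace_pi_primary (g : {'GL_4[F]}) (a : F) :
  char_poly (GLval g) = ('X - a%:P) ^+ 4 ->
  \tr (pi g) = - theta (emb a) * unip_value F C 4 (\rank (GLval g - a%:M)).
Proof.
move=> gE; rewrite trace_pi /cusp_value gE.
have cpE : map_poly emb (('X - a%:P) ^+ 4) = conj_poly F (emb a).
  rewrite rmorphXn /= rmorphB /= map_polyX map_polyC /conj_poly /=.
  under eq_bigr do rewrite exp_emb.
  by rewrite prodr_const card_ord.
have dE : conj_degree F (emb a) = 1%N by rewrite /conj_degree exp_emb_card eqxx.
rewrite (big_pred1 (emb a)) => [|x]; last first.
  by rewrite cpE eq_sym (conj_poly_eq cardK) /conjugates dE /= expn0 expr1 inE.
rewrite mulNr dE; congr (- (_ * _)).
have -> : geom_mult emb (GLval g) (emb a) = (4 - \rank (GLval g - a%:M)%R)%N.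
  rewrite /geom_mult mxrank_ker -(map_scalar_mx emb) -map_mxB mxrank_map.
  by [].
by rewrite /unip_value; under eq_bigr do rewrite mul1n.
Qed.

Lemma strict_upper_unip (u : {'GL_4[F]}) :
  strict_upper (GLval u - 1%:M) = (u \in unip_upper F 4).
Proof.
rewrite inE /strict_upper; apply: eq_forallb => i; apply: eq_forallb => j.
by rewrite !mxE subr_eq0.
Qed.

Lemma strict_upper_up (T : 'M[F]_(2 + 2)) :
  strict_upper T -> exists x y Z, T + 1%:M = up_mx x y Z.
Proof.
move/strict_upperP => H.
exists (ulsubmx T 0 1), (drsubmx T 0 1), (ursubmx T).
rewrite -{1}[T]submxK scalar_mx_block add_block_mx addr0 /up_mx.
have -> : dlsubmx T = 0.
  by apply/matrixP=> i j; rewrite !mxE H //= ltnW // ltn_addr.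
have E (A : 'M[F]_2) :
    (forall i j : 'I_2, (j <= i)%N -> A i j = 0) -> A + 1%:M = mx2 1 (A 0 1) 0 1.
  by move=> HA; rewrite [A in LHS]mx2_eta (HA 0 0) // (HA 1 0) // (HA 1 1) // !mx2E !add0r addr0.
by rewrite addr0 !E // => i j le; rewrite !mxE H //= leq_add2l.
Qed.

Lemma sum_unip_strict (f : 'M[F]_4 -> C) :
  \sum_(u in unip_upper F 4) f (GLval u - 1%:M) = \sum_(T | strict_upper T) f T.
Proof.
rewrite [RHS](reindex_onto (fun u : {'GL_4[F]} => GLval u - 1%:M)
  (fun T => @toGL F 4 (T + 1%:M))) /=.
  by apply: eq_bigl => u; rewrite strict_upper_unip subrK toGL_val eqxx andbT.
move=> T uT; rewrite toGLK ?addrK //.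
by have [x [y [Z ->]]] := strict_upper_up uT; apply: up_mx_unit.
Qed.

(** This is [unipotent_sum4]: the rank of [u - 1] determines the character at [u]. *)
Lemma bessel_one : bessel psi pi 1%g = 1.
Proof.
rewrite /bessel card_unip4.
transitivity ((q ^ 6)%:R^-1 * \sum_(u in unip_upper F 4)
  (- (psi (- superdiag (GLval u - 1%:M)) * unip_value F C 4 (\rank (GLval u - 1%:M))))).
  congr (_ * _); apply: eq_bigr => u uN; rewrite mul1g.
  have [x [y [Z uE]]] := unip4P _ uN.
  rewrite (trace_pi_primary (a := 1)); last by rewrite uE upGE char_poly_up.
  rewrite rmorph1 theta_char.1 mulN1r mulrN; congr (- (_ * _)).
  rewrite -(psiN psi_char); congr (psi (- _)).
  rewrite -[LHS]/(superdiag (GLval u)) /superdiag; apply: eq_bigr => i _.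
  apply: eq_bigr => j /eqP ji; rewrite !mxE.
  have /negPf -> : i != j by rewrite -val_eqE /= ji neq_ltn ltnSn.
  by rewrite subr0.
rewrite (sum_unip_strict (fun T => - (psi (- superdiag T) * unip_value F C 4 (\rank T)))).
by rewrite sumrN unipotent_sum4 // opprK natrX mulVf // expf_neq0 // card_neq0.
Qed.

Variables (omega : F -> C) (omega_pi : central_character pi omega).

(** Compare the traces at the scalar matrix [a] and at 1; their ratio is [theta a]
as they have the same, nonzero, value of [unip_value]. *)
Lemma central_characterE a : a != 0 -> omega a = theta (emb a).
Proof.
move=> a0.
have prim (b : F) : b != 0 -> d%:R * omega b = - theta (emb b) * unip_value F C 4 0.
  move=> b0; have ub : (b%:M : 'M[F]_4) \in unitmx.
    by rewrite unitmxE det_scalar unitfE expf_neq0.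
  have := @trace_pi_primary (@toGL F 4 b%:M) b; rewrite toGLK // subrr mxrank0 => <-.
    by rewrite omega_pi // mxtrace_scalar mulr_natl.
  rewrite char_poly_trig; last exact: scalar_mx_is_trig.
  by under eq_bigr do rewrite mxE eqxx; rewrite prodr_const card_ord.
have u0 : unip_value F C 4 0 != 0.
  rewrite /unip_value subn0 prodf_seq_neq0; apply/allP => j.
  rewrite mem_index_iota => /andP[j_gt0 _]; rewrite /= subr_eq0 eq_sym.
  by rewrite -natrX pnatr_eq1 gtn_eqF // -{1}(exp1n j) ltn_exp2r // finNzRing_gt1.
have d1 : d%:R = - unip_value F C 4 0.
  have := @trace_pi_primary 1%g 1; rewrite subrr mxrank0 rmorph1 theta_char.1 mulN1r => <-.
    by rewrite (repr_mx1 pi); exact/esym/mxtrace1.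
  rewrite char_poly_trig; last exact: scalar_mx_is_trig.
  by under eq_bigr do rewrite mxE eqxx; rewrite prodr_const card_ord.
have := prim a a0; rewrite d1 !mulNr => /oppr_inj; rewrite mulrC => /(mulIf u0). by [].
Qed.

Lemma bessel_scalar c g : c != 0 ->
  bessel psi pi (@toGL F 4 c%:M * g)%g = theta (emb c) * bessel psi pi g.
Proof.
move=> c0; rewrite /bessel mulrCA; congr (_ * _); rewrite mulr_sumr.
apply: eq_bigr => u _; rewrite -mulgA piM omega_pi // mul_scalar_mx mxtraceZ.
by rewrite central_characterE // mulrCA.
Qed.

Definition anti_mx (b c : F) : 'M[F]_(2 + 2) := block_mx 0 b%:M c%:M 0.

Lemma anti_mx_unit b c : b != 0 -> c != 0 -> anti_mx b c \in unitmx.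
Proof.
move=> b0 c0.
have E : anti_mx b c *m anti_mx c^-1 b^-1 = 1%:M.
  rewrite mulmx_block !mul0mx !mulmx0 !add0r !addr0 -!scalar_mxM !divff //.
  by rewrite -scalar_mx_block.
by case: (mulmx1_unit E).
Qed.

(** Conjugation by a block diagonal unipotent matrix brings [anti_mx t 1 * u] to block
companion form; only the sum [x + y] of the two diagonal block parameters of [u]
remains, whence one factor [q]. *)
Lemma bessel_anti_mx1 t : t != 0 ->
  bessel psi pi (@toGL F 4 (anti_mx t 1)) = bessel_value emb Tr Nm theta psi t.
Proof.
move=> t0; have ua := anti_mx_unit t0 (oner_neq0 F).
rewrite /bessel card_unip4 sum_unip4.
transitivity ((q ^ 6)%:R^-1 * \sum_(x : F) \sum_(y : F) \sum_(Z : 'M[F]_2)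
   psi (- (x + y) - Z 1 0) * cusp_value emb theta (companion t (x + y) Z)).
  congr (_ * _); apply: eq_bigr => x _; apply: eq_bigr => y _; apply: eq_bigr => Z _.
  rewrite psi_unip_up -(psiN psi_char) opprD; congr (_ * _).
  (* the conjugating matrix moves the left block of the unipotent to the right *)
  have comp_id : up_mx x 0 0 *m (anti_mx t 1 *m up_mx x y Z)
      = companion t (x + y) Z *m up_mx x 0 0.
    rewrite !mulmx_block !mul0mx !mulmx0 !add0r !addr0 -!mx2_scalar !mul1mx !mulmx1.
    rewrite mulmx0 mul_scalar_mx; congr block_mx.
    by rewrite !mx2E; congr mx2; ring.
  have uu := up_mx_unit x 0 0; have uc : companion t (x + y) Z \in unitmx.
    have := unitmx_mul (companion t (x + y) Z) (up_mx x 0 0); rewrite -comp_id.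
    by rewrite !unitmx_mul uu ua up_mx_unit !andbT => <-.
  have gE : (@toGL F 4 (anti_mx t 1)%R * upG x y Z)%g
    = ((upG x 0 0)^-1 * (@toGL F 4 (companion t (x + y) Z) * upG x 0 0))%g.
    apply: (mulgI (upG x 0 0)); rewrite mulKVg /upG -!toGL_mul ?up_mx_unit ?ua //.
      by rewrite comp_id.
    by rewrite unitmx_mul ua up_mx_unit.
  by rewrite gE trace_piC -mulgA mulgV mulg1 trace_pi toGLK.
transitivity ((q ^ 6)%:R^-1 * \sum_(x : F) \sum_(s : F) \sum_(Z : 'M[F]_2)
   psi (- s - Z 1 0) * cusp_value emb theta (companion t s Z)).
  congr (_ * _); apply: eq_bigr => x _.
  by rewrite [RHS](reindex_inj (addrI x)).
rewrite sumr_const (cusp_value_sum cardK TrE NmE) // /bessel_value -[_ *+ _]mulr_natl natrX.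
by field; rewrite card_neq0.
Qed.

Lemma bessel_anti_mx b c : b != 0 -> c != 0 ->
  bessel psi pi (@toGL F 4 (anti_mx b c))
  = theta (emb c) * bessel_value emb Tr Nm theta psi (b / c).
Proof.
move=> b0 c0; have bc0 : b / c != 0 by rewrite mulf_neq0 ?invr_eq0.
have uc : (c%:M : 'M[F]_(2 + 2)) \in unitmx.
  by rewrite unitmxE det_scalar unitfE expf_neq0.
rewrite -bessel_anti_mx1 // -bessel_scalar //; congr (bessel _ _ _).
rewrite -toGL_mul ?anti_mx_unit ?oner_neq0 //; congr (toGL _).
rewrite mul_scalar_mx /anti_mx scale_block_mx !scaler0 !scale_scalar_mx mulr1.
by rewrite mulrC divfK.
Qed.

End BesselValues.

(** * The matrices of the Jacquet-Shalika sums *)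

Section ShalikaMatrices.

Variable F : finFieldType.
Local Notation q := #|F|.

Definition shalika (g X : 'M[F]_2) : 'M[F]_(2 + 2) :=
  shuffle_mx F 1 *m block_mx 1%:M X 0 1%:M *m block_mx g 0 0 g.

Lemma shuffle_block :
  shuffle_mx F 1 = block_mx (mx2 1 0 0 0) (mx2 0 0 1 0) (mx2 0 1 0 0) (mx2 0 0 0 1).
Proof.
apply/matrixP=> i j; case: (split_ordP i) => i0 ->; case: (split_ordP j) => j0 ->;
rewrite ?block_mxEul ?block_mxEur ?block_mxEdl ?block_mxEdr !mxE;
by case: i0 => [[|[|//]] ?]; case: j0 => [[|[|//]] ?].
Qed.

Definition w2 : 'M[F]_2 := mx2 0 1 1 0.

Lemma antidiag_block : antidiag_mx F (2 + 2) = block_mx 0 w2 w2 0.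
Proof.
apply/matrixP=> i j; case: (split_ordP i) => i0 ->; case: (split_ordP j) => j0 ->;
rewrite ?block_mxEul ?block_mxEur ?block_mxEdl ?block_mxEdr !mxE;
by case: i0 => [[|[|//]] ?]; case: j0 => [[|[|//]] ?].
Qed.

Lemma block_mx2M (a b c d a' b' c' d' : 'M[F]_2) :
  block_mx a b c d *m block_mx a' b' c' d'
  = block_mx (a *m a' + b *m c') (a *m b' + b *m d') (c *m a' + d *m c') (c *m b' + d *m d').
Proof. exact: mulmx_block. Qed.

Lemma shuffle_sq : shuffle_mx F 1 *m shuffle_mx F 1 = 1%:M.
Proof.
rewrite shuffle_block block_mx2M !mx2E scalar_mx_block !mx2_scalar mx2_0.
by congr block_mx; congr mx2; ring.
Qed.

Lemma shuffle_unit : shuffle_mx F 1 \in unitmx.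
Proof. by case: (mulmx1_unit shuffle_sq). Qed.

Lemma swap_sq : swap_mx F 1 *m swap_mx F 1 = 1%:M.
Proof. by rewrite block_mx2M !mulmx0 !mulmx1 !addr0 !add0r scalar_mx_block. Qed.

Lemma swap_unit : swap_mx F 1 \in unitmx.
Proof. by case: (mulmx1_unit swap_sq). Qed.

Lemma shalika_unit g X : g \in unitmx -> shalika g X \in unitmx.
Proof.
move=> ug; rewrite !unitmx_mul shuffle_unit /= !unitmxE !det_ublock !det1 mulr1 unitr1 /=.
by rewrite unitrM -unitmxE ug.
Qed.

(** After the right translation by the shuffle, a block diagonal [diag (g, g)] becomes
the matrix [g] tensor 1 with scalar blocks, and the upper triangular part of [X]
becomes part of an upper triangular unipotent matrix. *)
Lemma shalikaE a b c d x1 x2 x3 x4 :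
  shalika (mx2 a b c d) (mx2 x1 x2 x3 x4) *m shuffle_mx F 1
  = block_mx (mx2 1 x1 0 1) (mx2 0 x2 0 0) (mx2 0 x3 0 0) (mx2 1 x4 0 1)
    *m block_mx a%:M b%:M c%:M d%:M.
Proof.
rewrite /shalika shuffle_block mx2_0 !mx2_scalar !block_mx2M !mx2E.
by congr block_mx; congr mx2; ring.
Qed.

Lemma shalika_translate (g X Y : 'M[F]_2) : Y 1 0 = 0 ->
  shalika g (Y + X) *m shuffle_mx F 1
  = up_mx (Y 0 0) (Y 1 1) (mx2 0 (Y 0 1) 0 0) *m (shalika g X *m shuffle_mx F 1).
Proof.
move=> Y0; rewrite (mx2_eta g) (mx2_eta X) (mx2_eta Y) Y0 mx2D !shalikaE mulmxA.
congr (_ *m _); rewrite /up_mx mx2_0 !mxE /= block_mx2M !mx2E.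
by congr block_mx; congr mx2; ring.
Qed.

Lemma shalika_conj (b : F) (g X : 'M[F]_2) :
  shalika (mx2 1 b 0 1 *m g) (mx2 1 b 0 1 *m X *m mx2 1 (- b) 0 1) *m shuffle_mx F 1
  = up_mx 0 0 b%:M *m (shalika g X *m shuffle_mx F 1).
Proof.
rewrite (mx2_eta g) (mx2_eta X) !mx2M !shalikaE /up_mx mx2_0 !mx2_scalar !block_mx2M !mx2E.
by congr block_mx; congr mx2; ring.
Qed.

(** With [dual_gl_mx], the involution of the variables [(g, X)] by which the dual sum
becomes the original one. *)
Definition dual_gl (g : 'M[F]_2) : 'M[F]_2 := w2 *m (invmx g)^T.
Definition dual_gl_mx (X : 'M[F]_2) : 'M[F]_2 := - (w2 *m X^T *m w2).

Lemma w2_sq : w2 *m w2 = 1%:M.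
Proof. by rewrite !mx2E; congr mx2; ring. Qed.

Lemma w2_tr : w2^T = w2. Proof. exact: mx2_tr. Qed.

Lemma dual_gl_unit g : g \in unitmx -> dual_gl g \in unitmx.
Proof.
move=> ug; rewrite unitmx_mul unitmx_tr unitmx_inv ug andbT.
by case: (mulmx1_unit w2_sq).
Qed.

Lemma dual_glK g : g \in unitmx -> dual_gl (dual_gl g) = g.
Proof.
move=> ug; have uw : w2 \in unitmx by case: (mulmx1_unit w2_sq).
have E : dual_gl g *m (g^T *m w2) = 1%:M.
  by rewrite /dual_gl -mulmxA (mulmxA _ g^T) -trmx_mul mulmxV // trmx1 mul1mx w2_sq.
have -> : dual_gl g = invmx (g^T *m w2).
  have ugw : g^T *m w2 \in unitmx by rewrite unitmx_mul unitmx_tr ug.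
  by rewrite -[LHS]mulmx1 -(mulmxV ugw) mulmxA E mul1mx.
by rewrite /dual_gl invmxK trmx_mul trmxK w2_tr mulmxA w2_sq mul1mx.
Qed.

Lemma dual_gl_mxK X : dual_gl_mx (dual_gl_mx X) = X.
Proof.
rewrite /dual_gl_mx (mx2_eta X) !(mx2M, mx2_tr, mx2N).
by congr mx2; ring.
Qed.

(** The swap of the two blocks turns the transposed, hence lower triangular, unipotent
factor back into an upper triangular one. *)
Lemma shalika_dual g X : g \in unitmx ->
  antidiag_mx F (2 + 2) *m (invmx (shalika g X *m swap_mx F 1))^T
  = shalika (dual_gl g) (dual_gl_mx X).
Proof.
move=> ug; set A := shalika g X *m _.
have uA : A \in unitmx by rewrite unitmx_mul shalika_unit // swap_unit.
have E : shalika (dual_gl g) (dual_gl_mx X) *m A^T = antidiag_mx F (2 + 2).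
  rewrite /A /shalika !trmx_mul !tr_block_mx !trmx1 !trmx0 -!mulmxA.
  have gg : dual_gl g *m g^T = w2.
    by rewrite /dual_gl -mulmxA -trmx_mul mulmxV // trmx1 mulmx1.
  have XX : dual_gl_mx X *m w2 + w2 *m X^T = 0.
    by rewrite /dual_gl_mx mulNmx -(mulmxA (w2 *m X^T)) w2_sq mulmx1 addNr.
  have mid : block_mx 1%:M (dual_gl_mx X) 0 1%:M *m (block_mx (dual_gl g) 0 0 (dual_gl g) *m
     (block_mx 0 1%:M 1%:M 0 *m (block_mx g^T 0 0 g^T *m block_mx 1%:M 0 X^T 1%:M)))
     = block_mx 0 w2 w2 0.
    have -> : block_mx (dual_gl g) 0 0 (dual_gl g) *m
       (block_mx 0 1%:M 1%:M 0 *m (block_mx g^T 0 0 g^T *m block_mx 1%:M 0 X^T 1%:M))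
       = block_mx (w2 *m X^T) w2 w2 0.
      by rewrite !block_mx2M !(mulmx0, mul0mx, mulmx1, mul1mx, addr0, add0r) mulmxA gg.
    by rewrite block_mx2M !(mulmx0, mul0mx, mul1mx, addr0, add0r) addrC XX.
  have mid' (M : 'M[F]_(2 + 2)) : block_mx 1%:M (dual_gl_mx X) 0 1%:M *m
     (block_mx (dual_gl g) 0 0 (dual_gl g) *m (block_mx 0 1%:M 1%:M 0 *m
     (block_mx g^T 0 0 g^T *m (block_mx 1%:M 0 X^T 1%:M *m M)))) = block_mx 0 w2 w2 0 *m M.
    by rewrite -mid !mulmxA.
  rewrite mid' antidiag_block shuffle_block tr_block_mx !mx2_tr mx2_0 !block_mx2M !mx2E.
  by congr block_mx; congr mx2; ring.
by rewrite -E -mulmxA -trmx_mul mulVmx // trmx1 mulmx1.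
Qed.

End ShalikaMatrices.

(** * The Jacquet-Shalika sums as averages *)

Section Averaging.

Variables (F : finFieldType) (C : numClosedFieldType).
Local Notation q := #|F|.
Local Notation GL2 := {'GL_2[F]}.
Local Notation M2 := 'M[F]_2.

Definition last_row : 'rV[F]_2 := delta_mx 0 ord_max.

Lemma unip2P (u : GL2) : reflect (exists b, GLval u = mx2 1 b 0 1) (u \in unip_upper F 2).
Proof.
rewrite inE; apply: (iffP forallP) => [H|[b ->] i]; last first.
  apply/forallP => j; apply/implyP.
  by case: i => [[|[|//]] ?]; case: j => [[|[|//]] ?]; rewrite // mxE.
have HA (i j : 'I_2) : (j <= i)%N -> GLval u i j = (i == j)%:R.
  by move=> le; have /forallP/(_ j)/implyP/(_ le)/eqP := H i.
exists (GLval u 0 1); rewrite [LHS]mx2_eta.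
by rewrite (HA 0 0) // (HA 1 0) // (HA 1 1).
Qed.

Lemma upper_mxP (X : M2) : reflect (X 1 0 = 0) (X \in upper_mx F 1).
Proof.
rewrite inE; apply: (iffP forallP) => [H|H i].
  by have /forallP/(_ 0)/implyP/(_ isT)/eqP := H 1.
apply/forallP => j; apply/implyP => lt_ji; apply/eqP; rewrite -[RHS]H.
by case: i j lt_ji => [[|[|//]] ?] [[|[|//]] ?] // _; congr (X _ _); apply: val_inj.
Qed.

Lemma unip2_group : group_set (unip_upper F 2).
Proof.
apply/group_setP; split=> [|u v /unip2P[b uE] /unip2P[c vE]].
  by apply/unip2P; exists 0; rewrite GL_1E [LHS]mx2_scalar.
apply/unip2P; exists (c + b); rewrite GL_MxE uE vE mx2M.
by congr mx2; ring.
Qed.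

Lemma upper_mx_group : group_set (upper_mx F 1).
Proof.
apply/group_setP; split=> [|X Y /upper_mxP X0 /upper_mxP Y0].
  by apply/upper_mxP; rewrite mxE.
by apply/upper_mxP; rewrite FinRing.zmodMgE mxE X0 Y0 addr0.
Qed.

Lemma last_row_unip b (g : M2) : last_row *m (mx2 1 b 0 1 *m g) = last_row *m g.
Proof.
rewrite mulmxA; congr (_ *m _); apply/rowP => j.
rewrite !mxE !big_ord_recl big_ord0 !mxE /=.
by case: j => [[|[|//]] ?] /=; rewrite ?mul0r ?mul1r ?mulr0 ?addr0 ?add0r.
Qed.

Definition JS_term (psi : F -> C) (W : {'GL_4[F]} -> C) (g X : M2) : C :=
  W (@toGL F 4 (shalika g X)) * psi (- \tr X).

(** The two invariance hypotheses make the summand well defined on cosets;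
conjugation of [X] accompanies translation of [g] because the block unipotent and
the block diagonal factor do not commute. *)
Lemma JS_average (psi : F -> C) (W : {'GL_4[F]} -> C) (phi : 'rV[F]_2 -> C) :
  (forall (g : GL2) (X Y : M2), Y 1 0 = 0 ->
     JS_term psi W (GLval g) (Y + X) = JS_term psi W (GLval g) X) ->
  (forall b (g : GL2) X,
     JS_term psi W (mx2 1 b 0 1 *m GLval g) (mx2 1 b 0 1 *m X *m mx2 1 (- b) 0 1)
     = JS_term psi W (GLval g) X) ->
  JS (m' := 1) psi W phi = (#|[set: GL2]|%:R * #|[set: M2]|%:R)^-1 *
    \sum_(g : GL2) \sum_(X : M2) JS_term psi W (GLval g) X * phi (last_row *m GLval g).
Proof.
move=> H1 H2.
pose N : {group GL2} := Group unip2_group.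
pose B : {group M2} := Group upper_mx_group.
pose G : {group GL2} := [set: GL2]%G.
pose M : {group M2} := [set: M2]%G.
transitivity ((#|G : N|%g%:R * #|M : B|%g%:R)^-1 *
  \sum_(A in rcosets N G) (\sum_(Y in rcosets B M)
     JS_term psi W (GLval (repr A)) (repr Y) * phi (last_row *m GLval (repr A)))).
  by [].
have sBM : B \subset M by apply: subsetT.
have sNG : N \subset G by apply: subsetT.
have step1 (g : GL2) : \sum_(Y in rcosets B M) JS_term psi W (GLval g) (repr Y)
      * phi (last_row *m GLval g)
    = #|B|%:R^-1 * \sum_(X : M2) JS_term psi W (GLval g) X * phi (last_row *m GLval g).
  rewrite (@sum_rcosets _ C B M (fun X =>
    JS_term psi W (GLval g) X * phi (last_row *m GLval g))) //.
    by congr (_ * _); apply: eq_bigl => X; rewrite inE.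
  by move=> Y X /upper_mxP Y0 _; rewrite FinRing.zmodMgE H1.
under eq_bigr do rewrite step1.
rewrite (@sum_rcosets _ C N G (fun g => #|B|%:R^-1 *
   \sum_(X : M2) JS_term psi W (GLval g) X * phi (last_row *m GLval g))) //; last first.
  move=> n g /unip2P[b nE] _; congr (_ * _); rewrite GL_MxE nE.
  pose h (X : M2) := mx2 1 b 0 1 *m X *m mx2 1 (- b) 0 1.
  have h_inj : injective h.
    move=> X Y /(congr1 (fun Z => mx2 1 (- b) 0 1 *m Z *m mx2 1 b 0 1)).
    have E : mx2 1 (- b) 0 1 *m mx2 1 b 0 1 = 1%:M :> M2.
      by rewrite !mx2E; congr mx2; ring.
    by rewrite /h -!mulmxA !E !mulmx1 !mulmxA !E !mul1mx.
  rewrite (reindex_inj h_inj) /=; apply: eq_bigr => X _.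
  by rewrite H2 last_row_unip.
rewrite -mulr_sumr !mulrA; congr (_ * _); last by apply: eq_bigl => g; rewrite inE.
rewrite -(card_coset_factor C sBM) -(card_coset_factor C sNG) -!invfM; congr (_^-1).
by ring.
Qed.

End Averaging.

Lemma GLval_unit (F : finFieldType) (u : {'GL_2[F]}) : (GLval u : 'M[F]_2) \in unitmx.
Proof. exact: (GL_unitmx u). Qed.

Section Duality.

Variables (F : finFieldType) (C : numClosedFieldType).
Local Notation q := #|F|.
Local Notation GL2 := {'GL_2[F]}.
Local Notation M2 := 'M[F]_2.
Variables (psi : F -> C) (psi_char : additive_char psi).
Variables (d : nat) (pi : mx_representation C 'GL_4[F] d).

Definition bessel_mx (A : 'M[F]_(2 + 2)) : C := bessel psi pi (@toGL F 4 A).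

Lemma bessel_mx_up_left x y Z A : A \in unitmx ->
  bessel_mx (up_mx x y Z *m A) = psi (x + y + Z 1 0) * bessel_mx A.
Proof.
move=> uA; rewrite /bessel_mx toGL_mul ?up_mx_unit // bessel_mul_left //.
  by rewrite -psi_unip_up.
by apply/unip4P; exists x, y, Z.
Qed.

Lemma bessel_mx_up_right x y Z A : A \in unitmx ->
  bessel_mx (A *m up_mx x y Z) = psi (x + y + Z 1 0) * bessel_mx A.
Proof.
move=> uA; rewrite /bessel_mx toGL_mul ?up_mx_unit // bessel_mul_right //.
  by rewrite -psi_unip_up.
by apply/unip4P; exists x, y, Z.
Qed.

Lemma shalika_shuffle_unit g (X : M2) :
  g \in unitmx -> shalika g X *m shuffle_mx F 1 \in unitmx.
Proof. by move=> ug; rewrite unitmx_mul shalika_unit // shuffle_unit. Qed.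

Definition bessel_shuffled (g : {'GL_4[F]}) : C :=
  bessel psi pi (g * @toGL F 4 (shuffle_mx F 1))%g.

Lemma JS_termE g X : g \in unitmx ->
  JS_term psi bessel_shuffled g X
  = bessel_mx (shalika g X *m shuffle_mx F 1) * psi (- \tr X).
Proof.
by move=> ug; rewrite /JS_term /bessel_mx toGL_mul ?shalika_unit ?shuffle_unit.
Qed.

Lemma JS_term_translate g (X Y : M2) : g \in unitmx -> Y 1 0 = 0 ->
  JS_term psi bessel_shuffled g (Y + X) = JS_term psi bessel_shuffled g X.
Proof.
move=> ug Y0.
rewrite !JS_termE // shalika_translate // bessel_mx_up_left ?shalika_shuffle_unit //.
rewrite [psi _ * bessel_mx _]mulrC -mulrA; congr (_ * _).
rewrite -(psiD psi_char); congr psi.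
have trY : \tr Y = Y 0 0 + Y 1 1 by rewrite {1}(mx2_eta Y) trace_mx2.
by rewrite mxtraceD trY mxE /=; ring.
Qed.

Lemma unip_unit (b : F) : mx2 1 b 0 1 \in unitmx.
Proof. by rewrite unitmxE det_mx2 mulr1 mulr0 subr0 unitr1. Qed.

Lemma JS_term_conj (b : F) g (X : M2) : g \in unitmx ->
  JS_term psi bessel_shuffled (mx2 1 b 0 1 *m g) (mx2 1 b 0 1 *m X *m mx2 1 (- b) 0 1)
  = JS_term psi bessel_shuffled g X.
Proof.
move=> ug; have uu := unip_unit b.
rewrite !JS_termE ?unitmx_mul ?uu // shalika_conj bessel_mx_up_left ?shalika_shuffle_unit //.
have -> : \tr (mx2 1 b 0 1 *m X *m mx2 1 (- b) 0 1) = \tr X.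
  by rewrite (mx2_eta X) !mx2M !trace_mx2; ring.
have -> : psi (0 + 0 + (b%:M : M2) 1 0) = 1.
  by rewrite mxE /= !addr0 (psi0 psi_char).
by rewrite mul1r.
Qed.

Definition dual_GL (g : GL2) : GL2 := @toGL F 2 (dual_gl (GLval g)).

Lemma dual_GLE g : GLval (dual_GL g) = dual_gl (GLval g).
Proof. exact/toGLK/dual_gl_unit/GLval_unit. Qed.

Lemma dual_GLK : involutive dual_GL.
Proof.
move=> g; apply: val_inj; rewrite -[LHS]/(GLval _) !dual_GLE.
exact/dual_glK/GLval_unit.
Qed.

Lemma trace_dual_gl_mx (X : M2) : \tr (dual_gl_mx X) = - \tr X.
Proof. by rewrite /dual_gl_mx (mx2_eta X) !(mx2M, mx2_tr, mx2N) !trace_mx2; ring. Qed.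

Lemma dual_term g X : g \in unitmx ->
  JS_term (fun x => (psi x)^-1)
    (fun h => whittaker_dual bessel_shuffled (h * @toGL F 4 (swap_mx F 1))%g) g X
  = JS_term psi bessel_shuffled (dual_gl g) (dual_gl_mx X).
Proof.
move=> ug; rewrite /JS_term trace_dual_gl_mx opprK -(psiN psi_char) opprK; congr (_ * _).
rewrite /whittaker_dual -toGL_mul ?shalika_unit ?swap_unit //.
have usw : shalika g X *m swap_mx F 1 \in unitmx.
  by rewrite unitmx_mul shalika_unit // swap_unit.
by rewrite toGLK //; congr (bessel_shuffled (toGL _)); apply: shalika_dual.
Qed.

Lemma dual_gl_unip (b : F) g : g \in unitmx ->
  dual_gl (mx2 1 b 0 1 *m g) = mx2 1 (- b) 0 1 *m dual_gl g.
Proof.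
move=> ug; have E : invmx (mx2 1 b 0 1 *m g) = invmx g *m mx2 1 (- b) 0 1.
  have uu : mx2 1 b 0 1 *m g \in unitmx by rewrite unitmx_mul unip_unit.
  rewrite -[RHS]mulmx1 -(mulmxV uu) !mulmxA -(mulmxA _ _ (mx2 1 b 0 1)).
  have -> : mx2 1 (- b) 0 1 *m mx2 1 b 0 1 = 1%:M by rewrite !mx2E; congr mx2; ring.
  by rewrite mulmx1 mulVmx // mul1mx.
rewrite /dual_gl E trmx_mul mulmxA [RHS]mulmxA; congr (_ *m _).
by rewrite mx2_tr /w2 !mx2M; congr mx2; ring.
Qed.

Lemma JS_bessel (phi : 'rV[F]_2 -> C) :
  JS (m' := 1) psi bessel_shuffled phi = (#|[set: GL2]|%:R * #|[set: M2]|%:R)^-1 *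
    \sum_(g : GL2) \sum_(X : M2) JS_term psi bessel_shuffled (GLval g) X
       * phi (last_row F *m GLval g).
Proof.
apply: JS_average => [g X Y Y0|b g X].
  by rewrite JS_term_translate ?GLval_unit.
by rewrite JS_term_conj ?GLval_unit.
Qed.

Lemma JS_dual_bessel (phi : 'rV[F]_2 -> C) :
  JS_dual (m' := 1) psi bessel_shuffled phi = (#|[set: GL2]|%:R * #|[set: M2]|%:R)^-1 *
    \sum_(g : GL2) \sum_(X : M2) JS_term psi bessel_shuffled (GLval g) X
       * fourier (m' := 1) psi phi (last_row F *m dual_gl (GLval g)).
Proof.
rewrite /JS_dual JS_average.
- congr (_ * _); rewrite (reindex_inj (inv_inj dual_GLK)) /=; apply: eq_bigr => g _.
  rewrite (reindex_inj (inv_inj (@dual_gl_mxK F))) /=; apply: eq_bigr => X _.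
  by rewrite dual_term ?GLval_unit // dual_GLE dual_gl_mxK dual_glK ?GLval_unit.
- move=> g X Y Y0; have ug := GLval_unit g; rewrite !dual_term //.
  have -> : dual_gl_mx (Y + X) = dual_gl_mx Y + dual_gl_mx X.
    by rewrite /dual_gl_mx linearD /= mulmxDr mulmxDl opprD.
  rewrite JS_term_translate ?dual_gl_unit //.
  by rewrite /dual_gl_mx (mx2_eta Y) Y0 !(mx2M, mx2_tr, mx2N) mxE /=; ring.
move=> b g X; have ug := GLval_unit g; rewrite !dual_term ?unitmx_mul ?unip_unit //.
rewrite dual_gl_unip //.
have -> : dual_gl_mx (mx2 1 b 0 1 *m X *m mx2 1 (- b) 0 1)
   = mx2 1 (- b) 0 1 *m dual_gl_mx X *m mx2 1 (- - b) 0 1.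
  by rewrite /dual_gl_mx (mx2_eta X) !(mx2M, mx2_tr, mx2N); congr mx2; ring.
by rewrite JS_term_conj // dual_gl_unit.
Qed.

End Duality.

Section Linearity.

Variables (F : finFieldType) (C : numClosedFieldType).
Local Notation GL4 := {'GL_4[F]}.

Lemma JS_sum (I : finType) (psi : F -> C) (W : I -> GL4 -> C) phi :
  JS (m' := 1) psi (fun g => \sum_i W i g) phi = \sum_i JS (m' := 1) psi (W i) phi.
Proof.
rewrite /JS -mulr_sumr; congr (_ * _); rewrite [RHS]exchange_big /=; apply: eq_bigr => A _.
rewrite [RHS]exchange_big /=; apply: eq_bigr => Y _.
by rewrite !mulr_suml.
Qed.

Lemma eq_JS (psi : F -> C) (W W' : GL4 -> C) phi : W =1 W' ->
  JS (m' := 1) psi W phi = JS (m' := 1) psi W' phi.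
Proof.
move=> E; rewrite /JS; congr (_ * _); apply: eq_bigr => A _; apply: eq_bigr => Y _.
by rewrite E.
Qed.

Variables (psi : F -> C) (psi_char : additive_char psi).
Variables (d : nat) (pi : mx_representation C 'GL_4[F] d).
Variables (gamma : C) (gamma_pi : ext_square_gamma (m' := 1) pi psi gamma).

(** A coordinate whose functional is zero is the zero function, and for it the
equation is trivial. *)
Lemma gamma_bessel phi :
  JS_dual (m' := 1) psi (bessel_shuffled psi pi) phi
  = gamma * JS (m' := 1) psi (bessel_shuffled psi pi) phi.
Proof.
pose s := @toGL F 4 (shuffle_mx F 1).
pose W := coordinate_whittaker psi pi s.
have WE g : bessel_shuffled psi pi g = \sum_i W i g.
  by rewrite sum_coordinate_whittaker.
have gammaW i : JS_dual (m' := 1) psi (W i) phi = gamma * JS (m' := 1) psi (W i) phi.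
  have [l0|l0] := eqVneq (row i (whittaker_proj psi pi)) 0.
    have W0 : W i =1 fun=> 0.
      by move=> g; rewrite /W /coordinate_whittaker l0 !mul0mx mxE.
    have JS0 (ps : F -> C) ph : JS (m' := 1) ps (fun=> 0) ph = 0.
      by rewrite /JS big1 ?mulr0 // => A _; rewrite big1 // => Y _; rewrite !mul0r.
    rewrite (eq_JS psi phi W0) JS0 mulr0 /JS_dual.
    rewrite -[RHS](JS0 (fun x => (psi x)^-1) (fourier (m' := 1) psi phi)).
    by apply: eq_JS => g; apply: W0.
  apply: gamma_pi.2; exists (row i (whittaker_proj psi pi)), (pi s *m col i 1%:M); split=> //.
  by move=> u uN; rewrite -row_mul whittaker_projM //; apply/rowP=> j; rewrite !mxE.
rewrite (eq_JS psi phi WE) JS_sum mulr_sumr -(eq_bigr _ (fun i _ => gammaW i)).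
rewrite /JS_dual -JS_sum; apply: eq_JS => g.
exact: WE.
Qed.

End Linearity.

(** * The gamma factor as a sum of Bessel values *)

Section GammaSum.

Variables (F K : finFieldType) (emb : {rmorphism F -> K}).
Local Notation q := #|F|.
Local Notation GL2 := {'GL_2[F]}.
Local Notation M2 := 'M[F]_2.
Hypothesis cardK : #|K| = (q ^ 4)%N.
Variables (Tr Nm : K -> F).
Hypothesis TrE : forall x, emb (Tr x) = \sum_(i < 4) x ^+ (q ^ i).
Hypothesis NmE : forall x, emb (Nm x) = \prod_(i < 4) x ^+ (q ^ i).
Variables (C : numClosedFieldType) (theta : K -> C).
Hypothesis theta_char : multiplicative_char theta.
Variables (psi : F -> C) (psi_char : additive_char psi).
Hypothesis psi_nontriv : exists x, psi x != 1.
Variables (d : nat) (pi : mx_representation C 'GL_4[F] d).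
Hypothesis trace_pi : forall g, \tr (pi g) = cusp_value emb theta (GLval g).
Variables (omega : F -> C) (omega_pi : central_character pi omega).

Local Notation bessel_mx := (bessel_mx psi pi).
Local Notation term := (JS_term psi (bessel_shuffled psi pi)).

(** The block matrix of the Jacquet-Shalika summand at [g = [a b; c e]], with [x]
the lower left entry of [X]. *)
Definition cell (a b c e x : F) : 'M[F]_(2 + 2) :=
  block_mx a%:M b%:M (mx2 c (a * x) 0 c) (mx2 e (b * x) 0 e).

Lemma term_cell a b c e x : a * e - b * c != 0 ->
  term (mx2 a b c e) (mx2 0 0 x 0) = bessel_mx (cell a b c e x).
Proof.
move=> g0; have ug : mx2 a b c e \in unitmx by rewrite unitmxE det_mx2 unitfE.
rewrite JS_termE // trace_mx2 addr0 oppr0 (psi0 psi_char) mulr1; congr bessel_mx.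
rewrite shalikaE /cell !block_mx2M !mx2E.
by congr block_mx; congr mx2; ring.
Qed.

(** The other three entries of [X] do not change the summand. *)
Lemma sum_term g : g \in unitmx ->
  \sum_X term g X = q%:R ^+ 3 * \sum_x term g (mx2 0 0 x 0).
Proof.
move=> ug; rewrite sum_mx2 mulr_sumr; apply: eq_bigr => x _.
transitivity (\sum_(a : F) \sum_(b : F) \sum_(e : F) term g (mx2 0 0 x 0)).
  apply: eq_bigr => a _; apply: eq_bigr => b _; apply: eq_bigr => e _.
  have -> : mx2 a b x e = mx2 a b 0 e + mx2 0 0 x 0 by rewrite mx2D; congr mx2; ring.
  by rewrite JS_term_translate // mxE.
by rewrite !sumr_const -!mulrnA -[LHS]mulr_natl !natrM; ring.
Qed.

(** A matrix that conjugates one unipotent element to another where [psi] has a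
different value lies outside the support of the Bessel function. *)
Lemma bessel_mx_vanish x y Z x' y' Z' A : A \in unitmx ->
  up_mx x y Z *m A = A *m up_mx x' y' Z' ->
  psi (x + y + Z 1 0) != psi (x' + y' + Z' 1 0) -> bessel_mx A = 0.
Proof.
move=> uA E ne; have := congr1 bessel_mx E.
rewrite bessel_mx_up_left // bessel_mx_up_right // => /eqP; rewrite -subr_eq0 -mulrBl.
by rewrite mulf_eq0 subr_eq0 (negPf ne) => /eqP.
Qed.

Lemma psi_nontriv_mul c : c != 0 -> exists y, psi (c * y) != 1.
Proof. by move=> c0; have [z hz] := psi_nontriv; exists (z / c); rewrite mulrC divfK. Qed.

(** Right multiplication by a unipotent matrix removes [b].  Then an element of the
root group (1,3) shows that [x] must be zero, and one of the root group (2,3)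
that [a = e]. *)
Lemma bessel_mx_parabolic a b e x : a != 0 -> e != 0 ->
  bessel_mx (cell a b 0 e x) = ((x == 0) && (a == e))%:R * theta (emb a).
Proof.
move=> a0 e0.
pose D : 'M[F]_(2 + 2) := block_mx a%:M 0 (mx2 0 (a * x) 0 0) e%:M.
have uD : D \in unitmx.
  rewrite unitmxE det_lblock !det_scalar unitfE.
  by rewrite mulf_neq0 // expf_neq0.
have -> : cell a b 0 e x = D *m up_mx 0 0 (b / a)%:M.
  rewrite /cell /D /up_mx mx2_0 block_mx2M !mx2E.
  by congr block_mx; congr mx2; field.
rewrite bessel_mx_up_right // mxE /= !addr0 (psi0 psi_char) mul1r.
have [x0|x0] := eqVneq x 0; last first.
  (* the root element (1,3) with parameter y is conjugated to one with
     superdiagonal entry x y *)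
  rewrite mul0r; have [y hy] := psi_nontriv_mul x0.
  apply: (@bessel_mx_vanish 0 0 (mx2 y 0 0 0) (x * y) 0 (mx2 (e / a * y) 0 0 0)) => //.
    rewrite /D /up_mx mx2_0 !block_mx2M !mx2E.
    by congr block_mx; congr mx2; field.
  by rewrite !mxE /= !addr0 (psi0 psi_char) eq_sym.
have DE : D = block_mx a%:M 0 0 e%:M by rewrite /D x0 mulr0 -mx2_0.
have [ae|ae] := eqVneq a e; last first.
  (* conjugation multiplies the parameter y of the root element (2,3) by e / a *)
  rewrite mul0r; have [|y hy] := @psi_nontriv_mul (1 - e / a).
    by rewrite subr_eq0 eq_sym; apply: contraNneq ae => h; rewrite eq_sym -(divfK a0 e) h mul1r.
  apply: (@bessel_mx_vanish 0 0 (mx2 0 0 y 0) 0 0 (mx2 0 0 (e / a * y) 0)) => //.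
    rewrite DE /up_mx mx2_0 !block_mx2M !mx2E.
    by congr block_mx; congr mx2; field.
  rewrite !mxE /= !add0r; apply: contraNneq hy => h.
  by rewrite mulrBl mul1r (psiD psi_char) h -(psiD psi_char) subrr (psi0 psi_char).
rewrite mul1r DE -ae -scalar_mx_block /bessel_mx.
rewrite -[X in bessel _ _ X]mulg1 (bessel_scalar cardK theta_char psi trace_pi omega_pi) //.
by rewrite (bessel_one cardK theta_char psi_char psi_nontriv trace_pi) mulr1.
Qed.

(** The Bruhat decomposition of [[a b; c e]] in GL_2, with corrections for [x] that
lie in unipotent matrices on which [psi] cancels. *)
Lemma bessel_mx_big_cell a b c e x : c != 0 -> b - a * e / c != 0 ->
  bessel_mx (cell a b c e x) = bessel_mx (anti_mx (b - a * e / c) c).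
Proof.
move=> c0 b0; have ua := anti_mx_unit b0 c0.
set b' := b - _ in b0 ua *.
(* [a b; c e] is the product of [1 r; 0 1] and [0 b'; c e] *)
pose r := a / c.
have -> : cell a b c e x = up_mx (- (r * x)) (r * x) r%:M *m (anti_mx b' c *m
    up_mx 0 0 (mx2 (e / c) (x * b' / c) 0 (e / c))).
  rewrite /cell /anti_mx /up_mx /r /b' mx2_0 !mx2_scalar !block_mx2M !mx2E.
  by congr block_mx; congr mx2; field.
rewrite bessel_mx_up_left ?unitmx_mul ?ua ?up_mx_unit // bessel_mx_up_right //.
by rewrite !mxE /= addNr !addr0 (psi0 psi_char) !mul1r.
Qed.

Lemma sum_GL2 (f : M2 -> C) :
  \sum_(g : GL2) f (GLval g)
  = \sum_c \sum_a \sum_b \sum_e (if a * e - b * c != 0 then f (mx2 a b c e) else 0).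
Proof.
transitivity (\sum_(A : M2 | A \in unitmx) f A).
  rewrite (reindex_onto (fun g : GL2 => GLval g) (fun A => @toGL F 2 A)) /=.
    by apply: eq_bigl => g; rewrite GLval_unit toGL_val eqxx.
  by move=> A uA; rewrite toGLK.
rewrite big_mkcond sum_mx2; apply: eq_bigr => c _; apply: eq_bigr => a _.
by apply: eq_bigr => b _; apply: eq_bigr => e _; rewrite unitmxE det_mx2 unitfE.
Qed.

Lemma sum_GL2_term (Phi : M2 -> C) :
  \sum_(g : GL2) \sum_X term (GLval g) X * Phi (GLval g)
  = q%:R ^+ 3 * \sum_c \sum_a \sum_e \sum_b (if a * e - b * c != 0 then
      (\sum_x bessel_mx (cell a b c e x)) * Phi (mx2 a b c e) else 0).
Proof.
rewrite (sum_GL2 (fun A => \sum_X term A X * Phi A)) mulr_sumr.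
apply: eq_bigr => c _; rewrite mulr_sumr; apply: eq_bigr => a _.
rewrite exchange_big mulr_sumr; apply: eq_bigr => e _; rewrite mulr_sumr.
apply: eq_bigr => b _; case: ifP => g0; last by rewrite mulr0.
rewrite -mulr_suml sum_term ?unitmxE ?det_mx2 ?unitfE // mulrA; congr (_ * _ * _).
by apply: eq_bigr => x _; apply: term_cell.
Qed.

Lemma last_row_mx2 a b c e : last_row F *m mx2 a b c e = \row_j (if j == 0 then c else e).
Proof.
apply/rowP => j; rewrite !mxE !big_ord_recl big_ord0 !mxE /=.
by rewrite mul0r mul1r add0r addr0.
Qed.

(** On the original side this test vector isolates the identity; its Fourier
transform is [q^-1 psi] of the last coordinate. *)
Definition row_delta (r : 'rV[F]_2) : C := (r == last_row F)%:R.

Lemma row_delta_mx2 a b c e :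
  row_delta (last_row F *m mx2 a b c e) = (c == 0)%:R * (e == 1)%:R.
Proof.
rewrite /row_delta last_row_mx2 -natrM mulnb; congr (nat_of_bool _)%:R.
apply/eqP/andP => [/rowP E|[/eqP-> /eqP->]].
  by have := E 0; have := E 1; rewrite !mxE /= => -> ->.
by apply/rowP => j; rewrite !mxE /=; case: j => [[|[|//]] ?].
Qed.

Lemma JS_row_delta :
  \sum_(g : GL2) \sum_X term (GLval g) X * row_delta (last_row F *m GLval g) = q%:R ^+ 4.
Proof.
rewrite (sum_GL2_term (fun A => row_delta (last_row F *m A))).
transitivity (q%:R ^+ 3 * (\sum_(c : F) (c == 0)%:R * (\sum_(a : F) (a == 1)%:R *
   (\sum_(e : F) (e == 1)%:R * \sum_(b : F) (1 : C))))); last first.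
  by rewrite !sum_delta sumr_const; ring.
congr (_ * _); apply: eq_bigr => c _; rewrite mulr_sumr; apply: eq_bigr => a _.
rewrite !mulr_sumr; apply: eq_bigr => e _; rewrite !mulr_sumr; apply: eq_bigr => b _.
rewrite row_delta_mx2; have [->|c0] := eqVneq c 0; last by rewrite !mul0r mulr0 if_same.
have [->|e1] := eqVneq e 1; last by rewrite mul0r !mulr0 if_same.
rewrite mulr0 subr0 !mulr1 mul1r; have [->|a0] := eqVneq a 0.
  by rewrite eq_sym oner_eq0.
transitivity (\sum_(x : F) (x == 0)%:R * ((a == 1)%:R * theta (emb a))).
  apply: eq_bigr => x _; rewrite bessel_mx_parabolic ?oner_neq0 //.
  by rewrite -mulnb natrM -mulrA.
rewrite sum_delta; have [->|] := eqVneq a 1; last by rewrite mul0r.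
by rewrite (rmorph1 emb) theta_char.1 mulr1.
Qed.

Lemma fourier_row_delta r : fourier (m' := 1) psi row_delta r = q%:R^-1 * psi (r 0 1).
Proof.
rewrite /fourier sqrtCK; congr (_ * _).
transitivity (\sum_(x : 'rV[F]_2) (x == last_row F)%:R * psi (\sum_i x 0 i * r 0 i)).
  by [].
rewrite sum_delta; congr psi.
rewrite !big_ord_recl big_ord0 !mxE /= mul0r mul1r add0r addr0.
by congr (r _ _); apply: val_inj.
Qed.

Lemma invmx_mx2 (a b c e : F) : a * e - b * c != 0 ->
  invmx (mx2 a b c e) = (a * e - b * c)^-1 *: mx2 e (- b) (- c) a.
Proof.
move=> g0; have ug : mx2 a b c e \in unitmx by rewrite unitmxE det_mx2 unitfE.
have E : mx2 a b c e *m ((a * e - b * c)^-1 *: mx2 e (- b) (- c) a) = 1%:M.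
  by rewrite !mx2E; congr mx2; field.
by rewrite -[RHS]mul1mx -(mulVmx ug) -mulmxA E mulmx1.
Qed.

Lemma dual_last_row (a b c e : F) : a * e - b * c != 0 ->
  (last_row F *m dual_gl (mx2 a b c e)) 0 1 = - c / (a * e - b * c).
Proof.
move=> g0; rewrite /dual_gl invmx_mx2 // mx2Z mx2_tr /w2 mx2M last_row_mx2 mxE /=.
by field.
Qed.

Lemma JS_dual_row_delta :
  \sum_(g : GL2) \sum_X term (GLval g) X
     * fourier (m' := 1) psi row_delta (last_row F *m dual_gl (GLval g))
  = q%:R ^+ 3 * (\sum_(a | a != 0) theta (emb a))
    + q%:R ^+ 5 * \sum_(b | b != 0) \sum_(c | c != 0) psi b^-1 * bessel_mx (anti_mx b c).
Proof.
have q0 := card_neq0 F C.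
rewrite (sum_GL2_term (fun A => fourier (m' := 1) psi row_delta (last_row F *m dual_gl A))).
rewrite (bigD1 0) //= mulrDr; congr (_ + _).
  transitivity (q%:R ^+ 3 * \sum_(a : F) (if a != 0 then theta (emb a) else 0)); last first.
    by rewrite -big_mkcond.
  congr (_ * _); apply: eq_bigr => a _.
  transitivity (\sum_(e : F) (e == a)%:R * (\sum_(b : F)
     (if a != 0 then q%:R^-1 * theta (emb a) else 0))); last first.
    rewrite sum_delta sumr_const -[LHS]mulr_natl; case: ifP => _; last by rewrite mulr0.
    by rewrite mulrA mulfV // mul1r.
  apply: eq_bigr => e _; rewrite mulr_sumr; apply: eq_bigr => b _.
  rewrite mulr0 subr0 mulf_eq0 negb_or.
  have [->|a0] /= := eqVneq a 0; first by rewrite mulr0.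
  have [->|e0] /= := eqVneq e 0; first by rewrite eq_sym (negPf a0) mul0r.
  rewrite fourier_row_delta dual_last_row; last by rewrite mulr0 subr0 mulf_neq0.
  rewrite oppr0 mul0r (psi0 psi_char) mulr1.
  transitivity ((\sum_(x : F) (x == 0)%:R * ((a == e)%:R * theta (emb a))) * q%:R^-1).
    congr (_ * _); apply: eq_bigr => x _; rewrite bessel_mx_parabolic //.
    by rewrite -mulnb natrM -mulrA.
  by rewrite sum_delta eq_sym; ring.
rewrite [X in _ = _ * X]exchange_big /= !mulr_sumr; apply: eq_bigr => c c0.
transitivity (q%:R ^+ 3 * \sum_(a : F) \sum_(e : F) \sum_(b : F)
   (if b != 0 then psi b^-1 * bessel_mx (anti_mx b c) else 0)); last first.
  rewrite -big_mkcond !sumr_const -!mulrnA -[X in _ * X = _]mulr_natl !natrM /=.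
  by ring.
congr (_ * _); apply: eq_bigr => a _; apply: eq_bigr => e _.
(* the new variable is b' = b - a e / c, so that the determinant is - b' c *)
rewrite (reindex_inj (addIr (a * e / c))) /=; apply: eq_bigr => b _.
have -> : a * e - (b + a * e / c) * c = - (b * c) by field.
rewrite oppr_eq0 mulf_eq0 (negPf c0) orbF; case: ifP => // b0.
have E : a * e - (b + a * e / c) * c = - (b * c) by field.
rewrite fourier_row_delta dual_last_row; last first.
  by rewrite E oppr_eq0 mulf_neq0.
have -> : - c / (a * e - (b + a * e / c) * c) = b^-1.
  by rewrite E; field; rewrite b0 oppr_eq0 mulf_neq0.
transitivity ((\sum_(x : F) bessel_mx (anti_mx b c)) * (q%:R^-1 * psi b^-1)).
  congr (_ * _); apply: eq_bigr => x _; rewrite bessel_mx_big_cell // addrK //.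
rewrite sumr_const -[_ *+ _]mulr_natl; field.
by rewrite q0.
Qed.

Variables (gamma : C) (gamma_pi : ext_square_gamma (m' := 1) pi psi gamma).

Lemma gamma_bessel_sum :
  gamma = q%:R^-1 * (\sum_(a : F | a != 0) theta (emb a))
  + q%:R * \sum_(b : F | b != 0) \sum_(c : F | c != 0)
        psi b^-1 * (theta (emb c) * bessel_value emb Tr Nm theta psi (b / c)).
Proof.
have q0 := card_neq0 F C.
have := gamma_bessel psi_char gamma_pi row_delta.
rewrite JS_bessel // JS_dual_bessel // mulrCA => /mulfI E.
have {E} := E _; rewrite JS_row_delta JS_dual_row_delta => E.
have card0 : (#|[set: GL2]|%:R * #|[set: M2]|%:R)^-1 != 0 :> C.
  by rewrite invr_neq0 // -natrM pnatr_eq0 -lt0n muln_gt0 !cardG_gt0.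
have : gamma = q%:R ^- 4 * (gamma * q%:R ^+ 4) by field; rewrite q0.
rewrite -(E card0) => ->.
have <- : \sum_(b | b != 0) \sum_(c | c != 0) psi b^-1 * bessel_mx (anti_mx b c)
  = \sum_(b | b != 0) \sum_(c | c != 0)
      psi b^-1 * (theta (emb c) * bessel_value emb Tr Nm theta psi (b / c)).
  apply: eq_bigr => b b0; apply: eq_bigr => c c0; congr (_ * _).
  exact: (bessel_anti_mx cardK TrE NmE theta_char psi_char psi_nontriv trace_pi omega_pi).
by field; rewrite q0.
Qed.

End GammaSum.

(** * The theorem *)

Section GaloisSums.

Variables (F : finFieldType) (L : fieldExtType F).
Hypothesis dimL : \dim {:L} = 4%N.
Local Notation K := (finvect_type L).
Local Notation q := #|F|.
Local Notation emb := (in_alg K : {rmorphism F -> K}).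

(** The Galois group is generated by the Frobenius. *)
Lemma big_gal (R : Type) (idx : R) (op : Monoid.com_law idx) (f : K -> R) (x : K) :
  \big[op/idx]_(s in 'Gal({:K} / 1)%g) f (s x) = \big[op/idx]_(i < 4) f (x ^+ (q ^ i)).
Proof.
have [a gen_a aE] := finField_galois_generator (sub1v {:K}%AS).
have galE : 'Gal({:K} / 1)%g = <[a]>%g by apply/eqP.
have oa : #[a]%g = 4%N.
  rewrite /order -galE -galois_dim ?finField_galois ?sub1v // dimv1 divn1.
  exact: dimL.
have powE i : (a ^+ i)%g x = x ^+ (q ^ i).
  elim: i => [|i IH]; first by rewrite expg0 gal_id expn0 expr1.
  rewrite expgSr galM ?memvf // IH aE ?memvf // dimv1 expn1 -exprM -expnSr.
  by [].
have -> : 'Gal({:K} / 1)%g = [set (a ^+ i)%g | i : 'I_4].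
  rewrite galE; apply/setP=> s; apply/idP/imsetP => [/cyclePmin[i]|[i _ ->]].
    by rewrite oa => lti ->; exists (Ordinal lti).
  exact: mem_cycle.
rewrite big_imset /=; last first.
  move=> i j _ _ /eqP; rewrite eq_expg_mod_order oa !modn_small //.
  by move/eqP/val_inj.
by apply: eq_bigr => i _; rewrite powE.
Qed.

Lemma galTrace_sum_conj (x : K) : galTrace 1 {:K} x = \sum_(i < 4) x ^+ (q ^ i).
Proof. exact: (big_gal _ id). Qed.

Lemma galNorm_prod_conj (x : K) : galNorm 1 {:K} x = \prod_(i < 4) x ^+ (q ^ i).
Proof. exact: (big_gal _ id). Qed.

Lemma trace_ext_sum (x : K) : emb (@trace_ext F L x) = \sum_(i < 4) x ^+ (q ^ i).
Proof. by rewrite -galTrace_sum_conj; apply: (@trace_extE F L x). Qed.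

Lemma norm_ext_prod (x : K) : emb (@norm_ext F L x) = \prod_(i < 4) x ^+ (q ^ i).
Proof. by rewrite -galNorm_prod_conj; apply: (@norm_extE F L x). Qed.

End GaloisSums.

Theorem theorem2p39
  (C : numClosedFieldType) (F : finFieldType)
  (F4 : fieldExtType F) (dimF4 : \dim {:F4} = 4%N)
  (F2 : {subfield F4}) (dimF2 : \dim F2 = 2%N)
  (psi : F -> C) (psi_char : additive_char psi) (psi_nontriv : exists x, psi x != 1)
  (theta : F4 -> C) (theta_regular : regular_char theta)
  (theta_nontriv : nontrivial_on theta F2)
  (d : nat) (pi : mx_representation C 'GL_4[F] d)
  (pi_irr : mx_irreducible pi) (pi_cusp : cuspidal pi)
  (pi_theta : associated pi theta)
  (omega : F -> C) (omega_pi : central_character pi omega)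
  (gamma : C) (gamma_pi : ext_square_gamma (m' := 1) pi psi gamma) :
  let q : C := #|F|%:R in
  let T0 : C := if [forall a : F, (a != 0) ==> (omega a == 1)]
                then q ^+ 2 - 1 else 0 in
  let Tr := @trace_ext F F4 in
  let N := @norm_ext F F4 in
  gamma =
    q ^- 2 * T0
    - 2^-1 * q ^- 3 * gauss_sum psi theta *
      (\sum_(xi : finvect_type F4 | xi != 0)
        theta (xi ^+ 2) *
        kloosterman psi 1 (Tr (1 / xi ^+ 2) + Tr (xi ^+ 2) / N xi))
    - 2^-1 * q ^- 3 * gauss_sum psi theta *
      (\sum_(xi : finvect_type F4 | xi != 0)
        theta (xi ^+ 2) *
        kloosterman psi 1 (Tr (1 / xi ^+ 2) - Tr (xi ^+ 2) / N xi)).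
Proof.
move=> q T0 Tr N.
pose K := finvect_type F4.
pose emb : {rmorphism F -> K} := in_alg K.
have cardK : #|K| = (#|F| ^ 4)%N := card_ext dimF4.
have TrE (x : K) : emb (Tr x) = \sum_(i < 4) x ^+ (#|F| ^ i) := trace_ext_sum dimF4 x.
have NE (x : K) : emb (N x) = \prod_(i < 4) x ^+ (#|F| ^ i) := norm_ext_prod dimF4 x.
have theta_char : multiplicative_char (theta : K -> C) := theta_regular.1.
have trace_pi g : \tr (pi g) = cusp_value emb (theta : K -> C) (GLval g).
  exact: (character_formula dimF4 dimF2 pi_theta g).
have omegaE a : a != 0 -> omega a = theta (emb a).
  exact: (central_characterE cardK theta_char trace_pi omega_pi).
have [h [hF2 h0 th1]] := theta_nontriv.
have h2 : (h : K) ^+ (#|F| ^ 2) = h.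
  by move: hF2; rewrite Fermat's_little_theorem dimF2 => /eqP.
rewrite (gamma_bessel_sum cardK TrE NE theta_char psi_char psi_nontriv trace_pi
  omega_pi gamma_pi).
rewrite (gamma_identity cardK TrE NE theta_char psi_char psi_nontriv h0 h2 th1).
have T0E : T0 = if [forall a : F, (a != 0) ==> (theta (emb a) == 1)] then q ^+ 2 - 1 else 0.
  rewrite /T0; congr (if _ then _ else _); apply: eq_forallb => a.
  by have [//|a0] := eqVneq a 0; rewrite /= omegaE.
by rewrite T0E.
Qed.
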